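(* If a class $\mathcal C$ of finite structures is expressible in extensional ESO, then $\mathcal C$ is disjunctive self-reducible. In particular, for every finitely bounded structure $\mathbb B$, the problem $\mathrm{CSP}(\mathbb B)$ is disjunctive self-reducible.
   Context: All signatures are finite and relational, and all structures have non-empty domains. An ESO $\tau$-sentence has the form $\exists R_1,\dots,R_k.\,\phi$, where $R_1,\dots,R_k\notin\tau$ and $\phi$ is a first-order $(\tau\cup\{R_1,\dots,R_k\})$-sentence. It is extensional if for every existentially quantified predicate $R$ there is a distinct symbol $R'\in\tau$ of the same arity such that the sentence contains a conjunct $\forall\bar x\,(R'(\bar x)\Rightarrow R(\bar x))$, and $R'$ does not appear anywhere else in the sentence. A class of finite $\tau$-structures is expressible in extensional ESO if it is the class of finite models of some extensional ESO $\tau$-sentence. $\mathrm{CSP}(\mathbb B)$ is the class of finite structures that admit a homomorphism to $\mathbb B$; $\mathbb B$ is finitely bounded if there is a finite set $\mathcal F$ of finite structures such that a finite structure $\mathbb A$ embeds into $\mathbb B$ if and only if no structure from $\mathcal F$ embeds into $\mathbb A$. Finite structures are encoded as words in $\{0,1\}^*$. A polynomial-time computable partial order $<$ on $\{0,1\}^*$ is OK if there is a polynomial $p$ such that (i) every chain $x_1<\cdots<x_n$ of words satisfies $n\le p(|x_n|)$, and (ii) for all $x,y$, $x<y$ implies $|x|\le p(|y|)$. A set $L\subseteq\{0,1\}^*$ is disjunctive self-reducible if there are an OK partial order $<$ and a deterministic polynomial-time oracle machine $M$ that accepts $L$ using $L$ as its oracle, such that on every input $x$ the machine either decides whether $x\in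 L$ without calling the oracle, or computes queries $x_1,\dots,x_n\in\{0,1\}^*$, all strictly smaller than $x$ with respect to $<$, such that $x\in L$ if and only if $\{x_1,\dots,x_n\}\cap L\neq\varnothing$. *)

(* Defs.v *)
From mathcomp Require Import all_boot ssralg poly.
From mathcomp Require Import boolp classical_sets cardinality.

Set Implicit Arguments.
Unset Strict Implicit.
Unset Printing Implicit Defensive.

Local Open Scope classical_set_scope.

Record signature := Signature { rsym :> finType; ar : rsym -> nat }.

Record structure (tau : signature) := Structure {
  dom :> Type;
  dom_nonempty : inhabited dom;
  interp : forall R : tau, (ar R).-tuple dom -> Prop
}.

Definition finite_structure (tau : signature) (A : structure tau) : Prop :=
  finite_set [set: A].

Definition homomorphism (tau : signature) (A B : structure tau) (h : A -> B) :=
  forall (R : tau) (t : (ar R).-tuple A),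
    interp t -> interp (map_tuple h t).

Definition embedding (tau : signature) (A B : structure tau) (h : A -> B) :=
  injective h /\
  forall (R : tau) (t : (ar R).-tuple A),
    interp t <-> interp (map_tuple h t).

Definition embeds (tau : signature) (A B : structure tau) : Prop :=
  exists h : A -> B, embedding h.

Definition class (tau : signature) := structure tau -> Prop.

Definition CSP (tau : signature) (B : structure tau) : class tau :=
  fun A => finite_structure A /\ exists h : A -> B, homomorphism h.

Definition finitely_bounded (tau : signature) (B : structure tau) : Prop :=
  exists (k : nat) (F : 'I_k -> structure tau),
    (forall i, finite_structure (F i)) /\
    forall A : structure tau, finite_structure A ->
      (embeds A B <-> forall i, ~ embeds (F i) A).

Inductive fo (sigma : signature) : Type :=
| FFalse
| FEq of nat & nat
| FRel (R : sigma) of (ar R).-tuple nat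
| FNot of fo sigma
| FAnd of fo sigma & fo sigma
| FOr of fo sigma & fo sigma
| FImp of fo sigma & fo sigma
| FAll of nat & fo sigma
| FEx of nat & fo sigma.

Arguments FFalse {sigma}.
Arguments FEq {sigma}.

Section FirstOrder.
Variable sigma : signature.
Implicit Types (A : structure sigma) (phi psi : fo sigma).

Definition update (D : Type) (e : nat -> D) (x : nat) (a : D) : nat -> D :=
  fun y => if y == x then a else e y.

Fixpoint sat A (e : nat -> A) phi : Prop :=
  match phi with
  | FFalse => False
  | FEq x y => e x = e y
  | FRel R v => interp (map_tuple e v)
  | FNot psi => ~ sat e psi
  | FAnd psi1 psi2 => sat e psi1 /\ sat e psi2
  | FOr psi1 psi2 => sat e psi1 \/ sat e psi2
  | FImp psi1 psi2 => sat e psi1 -> sat e psi2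
  | FAll x psi => forall a, sat (update e x a) psi
  | FEx x psi => exists a, sat (update e x a) psi
  end.

Fixpoint free_vars phi : seq nat :=
  match phi with
  | FFalse => [::]
  | FEq x y => [:: x; y]
  | FRel R v => v
  | FNot psi => free_vars psi
  | FAnd psi1 psi2 | FOr psi1 psi2 | FImp psi1 psi2 =>
      free_vars psi1 ++ free_vars psi2
  | FAll x psi | FEx x psi => [seq y <- free_vars psi | y != x]
  end.

Fixpoint occurrences (S : sigma) phi : nat :=
  match phi with
  | FFalse | FEq _ _ => 0
  | FRel R _ => R == S
  | FNot psi | FAll _ psi | FEx _ psi => occurrences S psi
  | FAnd psi1 psi2 | FOr psi1 psi2 | FImp psi1 psi2 =>
      occurrences S psi1 + occurrences S psi2
  end.

Fixpoint conjunct psi phi : Prop :=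
  psi = phi \/
  match phi with
  | FAnd phi1 phi2 => conjunct psi phi1 \/ conjunct psi phi2
  | _ => False
  end.

(* [forall xs, S xs => R xs] for pairwise distinct variables [xs]; the two
   tuples have the same underlying sequence, so [S] and [R] have the same
   arity. *)
Definition extension_axiom (S R : sigma) phi : Prop :=
  exists (xs : (ar S).-tuple nat) (ys : (ar R).-tuple nat),
    [/\ uniq xs, val xs = val ys &
        phi = foldr (@FAll sigma) (FImp (FRel xs) (FRel ys)) xs].

End FirstOrder.

Definition sum_sig (tau sigma : signature) : signature :=
  @Signature (tau + sigma)%type
    (fun R => match R with inl P => ar P | inr P => ar P end).

Definition given (tau sigma : signature) (R : tau) : sum_sig tau sigma := inl R.
Definition added (tau sigma : signature) (R : sigma) : sum_sig tau sigma := inr R.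

Definition expansion (tau sigma : signature) (A : structure tau)
    (I : forall R : sigma, (ar R).-tuple A -> Prop) :
    structure (sum_sig tau sigma) :=
  @Structure (sum_sig tau sigma) A (dom_nonempty A)
    (fun R => match R with inl P => @interp tau A P | inr P => I P end).

(* [exists R_1 ... R_k, body], the [R_i] being the symbols of [quantified]. *)
Record eso (tau : signature) := ESO {
  quantified : signature;
  body : fo (sum_sig tau quantified);
  body_sentence : free_vars body = [::]
}.

Definition eso_models (tau : signature) (A : structure tau) (Phi : eso tau) :
    Prop :=
  exists I : forall R : quantified Phi, (ar R).-tuple A -> Prop,
    forall e : nat -> A, @sat _ (expansion I) e (body Phi).

(* An extension axiom contains exactly one occurrence of its premise symbol,
   so that one occurrence in total means that it does not occur elsewhere. *)
Definition extensional (tau : signature) (Phi : eso tau) : Prop :=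
  exists input : quantified Phi -> tau,
    injective input /\
    forall R : quantified Phi,
      (exists psi : fo (sum_sig tau (quantified Phi)),
         extension_axiom (given _ (input R)) (added tau R) psi /\
         conjunct psi (body Phi)) /\
      occurrences (given _ (input R)) (body Phi) = 1.

Definition extensional_eso_expressible (tau : signature) (C : class tau) : Prop :=
  exists Phi : eso tau, extensional Phi /\
    forall A : structure tau, C A <-> finite_structure A /\ eso_models A Phi.

Definition word := seq bool.

(* The [m]-th [k]-tuple over [{0, ..., n}] in lexicographic order: the [k]
   base-[n.+1] digits of [m], most significant first. *)
Definition lex_tuple (n k m : nat) : k.-tuple 'I_n.+1 :=
  [tuple inord ((m %/ n.+1 ^ (k - i.+1)) %% n.+1) | i < k].

Definition structure_on (tau : signature) (n : nat)
    (I : forall R : tau, (ar R).-tuple 'I_n.+1 -> Prop) : structure tau :=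
  @Structure tau 'I_n.+1 (inhabits ord0) I.

(* The domain size in unary, a separator, and the characteristic sequence of
   each relation. *)
Definition encode (tau : signature) (n : nat)
    (I : forall R : tau, (ar R).-tuple 'I_n.+1 -> Prop) : word :=
  nseq n.+1 true ++ false ::
  flatten [seq [seq `[< I R (lex_tuple n (ar R) m) >] | m <- iota 0 (n.+1 ^ ar R)]
          | R <- enum tau].

(* As usual, a finite structure is encoded through an isomorphic copy whose
   domain is an initial segment of the natural numbers. *)
Definition language_of (tau : signature) (C : class tau) : set word :=
  [set w | exists (n : nat) (I : forall R : tau, (ar R).-tuple 'I_n.+1 -> Prop),
             C (structure_on I) /\ w = encode I].

(* Tape cells: [None] is the blank, [Some (inl b)] an input bit, and
   [Some (inr g)] an auxiliary symbol. *)
Definition cell (G : finType) : finType := option (bool + G)%type.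

(* A two-way infinite tape: the cells left of the head (nearest first), and the
   cells from the head rightwards; all cells beyond either end are blank. *)
Record tape (G : finType) := Tape { tleft : seq (cell G); tright : seq (cell G) }.

Variant move := MoveLeft | Stay | MoveRight.

Section Tapes.
Variable G : finType.
Implicit Types t : tape G.

Definition read t : cell G := head None (tright t).

Definition write (a : cell G) t : tape G :=
  Tape (tleft t) (a :: behead (tright t)).

Definition move_head (d : move) t : tape G :=
  match d with
  | MoveLeft => Tape (behead (tleft t)) (head None (tleft t) :: tright t)
  | Stay => t
  | MoveRight => Tape (read t :: tleft t) (behead (tright t))
  end.

Definition input_tape (w : word) : tape G :=
  Tape [::] [seq Some (inl b) | b <- w].

Fixpoint leading_bits (s : seq (cell G)) : word :=
  if s is Some (inl b) :: s' then b :: leading_bits s' else [::].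

Definition tape_word t : word := leading_bits (tright t).
End Tapes.

Record machine := Machine {
  ntapes : nat;
  aux : finType;
  state : finType;
  start : state;
  accept : state;
  reject : state;
  trans : state -> {ffun 'I_ntapes -> cell aux} ->
          state * ('I_ntapes -> cell aux * move)
}.

Record config (M : machine) := Config {
  cstate : state M;
  ctapes : {ffun 'I_(ntapes M) -> tape (aux M)}
}.

Section Runs.
Variable M : machine.
Implicit Types c : config M.

(* The [i]-th input word is on the [i]-th tape, the other tapes are blank. *)
Definition init (ws : seq word) : config M :=
  Config (start M) [ffun i : 'I_(ntapes M) => input_tape (aux M) (nth [::] ws i)].

Definition accepting c : bool := cstate c == accept M.
Definition halted c : bool := accepting c || (cstate c == reject M).

Definition step c : config M :=
  if halted c then c else
  let: (q, act) := trans (cstate c) [ffun i => read (ctapes c i)] in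
  Config q [ffun i => move_head (act i).2 (write (act i).1 (ctapes c i))].
End Runs.

Definition polytime_relation (r : rel word) : Prop :=
  exists (M : machine) (p : {poly nat}), forall x y : word,
    let c := iter p.[size x + size y]%R (@step M) (init M [:: x; y]) in
    halted c /\ accepting c = r x y.

(* In the state [ask], the machine moves in one step to [yes] or [no] according
   to the oracle's answer to the word on the query tape (read from the head up
   to the first cell that does not hold a bit); the tapes do not change. *)
Record oracle_machine := OracleMachine {
  base :> machine;
  query_tape : 'I_(ntapes base);
  ask : state base;
  yes : state base;
  no : state base
}.

Section OracleRuns.
Variable M : oracle_machine.
Implicit Types (c : config M) (O : set word).

Definition query c : option word :=
  if ~~ halted c && (cstate c == ask M)
  then Some (tape_word (ctapes c (query_tape M))) else None.

Definition ostep O c : config M :=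
  if query c is Some w
  then Config (if `[< O w >] then yes M else no M) (ctapes c)
  else step c.

Definition orun O (x : word) (t : nat) : config M :=
  iter t (ostep O) (init M [:: x]).

Definition oaccepts O (x : word) : Prop := exists t, accepting (orun O x t).

Definition queries O (x : word) : set word :=
  [set w | exists t, query (orun O x t) = Some w].

Definition polytime_oracle_machine : Prop :=
  exists p : {poly nat}, forall O (x : word), halted (orun O x p.[size x]%R).
End OracleRuns.

Definition strict_partial_order (lt : rel word) : Prop :=
  irreflexive lt /\ transitive lt.

Definition OK_order (lt : rel word) : Prop :=
  [/\ strict_partial_order lt, polytime_relation lt &
    exists p : {poly nat},
      (forall s : seq word,
         sorted lt s -> size s <= p.[size (last [::] s)]%R) /\
      (forall x y : word, lt x y -> size x <= p.[size y]%R)].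

Definition disjunctive_self_reducible (L : set word) : Prop :=
  exists lt : rel word, OK_order lt /\
  exists M : oracle_machine, polytime_oracle_machine M /\
  forall x : word,
    (oaccepts M L x <-> L x) /\
    (queries M L x = set0 \/
     (queries M L x `<=` [set q | lt q x] /\
      (L x <-> queries M L x `&` L !=set0))).

Definition class_disjunctive_self_reducible (tau : signature) (C : class tau) : Prop :=
  disjunctive_self_reducible (language_of C).

(* Main.v *)
Require Import Defs.
From mathcomp Require Import all_boot ssralg poly.
From mathcomp Require Import boolp classical_sets cardinality.
From mathcomp Require Import zify.

Set Implicit Arguments.
Unset Strict Implicit.
Unset Printing Implicit Defensive.

(** Both parts follow from one property of a class [C]. There are a first-order
    sentence [phi] and a set [S] of input symbols such that a structure is in
    [C] if and only if it satisfies [phi] or some structure that has one more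
    tuple, in a relation of [S], is in [C]. Then [C] is disjunctive
    self-reducible ([one_step_self_reducible]): evaluate [phi] on the input,
    accept if it holds, and otherwise ask for all words that arise by turning
    a single 0 of the blocks of [S] into 1. These words are smaller for the
    order in which a word lies below the words of the same length that are
    pointwise smaller; a chain for this order gains a 1 in each step, hence
    has at most one word more than the length.

    For an extensional sentence, [phi] says that the input relations
    themselves are a witness, and [S] consists of the input symbols. A witness
    contains the input relations. If it is not equal to them, it contains a
    tuple that can be added to an input relation; it remains a witness, since
    an input symbol occurs only in its extension axiom
    ([extensional_self_reducible]).

    For a finitely bounded [B], call two elements of a structure twins if no
    relation distinguishes them; [phi] says that the quotient by twins omits
    the bounds, that is, embeds into [B], and [S] consists of all symbols. A
    homomorphism [h] to [B] either also reflects the relations, or some tuple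
    can be added to a relation such that [h] is still a homomorphism. In the
    first case elements with the same image are twins, so the quotient by
    twins is isomorphic to a substructure of the image, and [phi] holds.
    Being twins is first-order definable, so the kernel of [h] need not be
    quantified ([csp_self_reducible]).

    The remaining work is to build the oracle machine. It is composed of
    modules, control-flow graphs with one entry and one exit, which are wired
    into an oracle machine by [machine_ofP]. Above them there is a language of
    loop programs: its registers hold numbers up to the size [N] of the domain
    of the input structure and each loop is bounded by a register, so that all
    programs run in polynomial time ([oracle_machineP]). The variables of
    [phi] are kept in registers, and the bit of an atom is reached by moving
    the head with nested loops, because the position of a tuple is the value
    of its entries as digits in base [N] ([bit_at]). *)

(** * Control-flow modules *)

(** Cells left of cell [0] are blank. A move to the left from cell [0] shifts
    the contents by one cell, so natural numbers suffice as positions. *)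
Record atape := ATape { cont : nat -> option bool; hd : nat }.

Definition aread (a : atape) : option bool := cont a (hd a).

Definition upd (T : eqType) (U : Type) (f : T -> U) (x : T) (u : U) : T -> U :=
  fun y => if y == x then u else f y.

Definition amove (d : move) (b : option bool) (a : atape) : atape :=
  let C := upd (cont a) (hd a) b in
  match d with
  | MoveRight => ATape C (hd a).+1
  | Stay => ATape C (hd a)
  | MoveLeft => if hd a is q.+1 then ATape C q
                else ATape (fun j => if j is j'.+1 then C j' else None) 0
  end.

(** [onth w (size w)] is [None]: the cell after the word is not a bit. *)
Definition holds_word (a : atape) (w : word) :=
  forall i, i <= size w -> cont a (hd a + i) = onth w i.

Lemma upd_id (T : eqType) (U : Type) (f : T -> U) x : upd f x (f x) = f.
Proof. by apply/funext => y; rewrite /upd; case: eqP => // ->. Qed.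

Lemma upd_eq (T : eqType) (U : Type) (f : T -> U) x u : upd f x u x = u.
Proof. by rewrite /upd eqxx. Qed.

Lemma upd_neq (T : eqType) (U : Type) (f : T -> U) x y u :
  y != x -> upd f x u y = f y.
Proof. by rewrite /upd => /negPf ->. Qed.

Lemma upd_upd (T : eqType) (U : Type) (f : T -> U) x u v :
  upd (upd f x u) x v = upd f x v.
Proof. by apply/funext => y; rewrite /upd; case: eqP. Qed.

Lemma updC (T : eqType) (U : Type) (f : T -> U) x y u v :
  x != y -> upd (upd f x u) y v = upd (upd f y v) x u.
Proof.
move=> nxy; apply/funext => z; rewrite /upd; case: eqP => [->|//].
by rewrite eq_sym (negPf nxy).
Qed.

Section Modules.
Variables (reg flag : finType) (ans : flag).

Definition flags := {ffun flag -> bool}.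
Definition updf (f : flags) (x : flag) (b : bool) : flags := [ffun y => upd f x b y].
Definition tix := option reg.
Definition memory := (flags * (tix -> atape))%type.
Definition acts := tix -> option bool * move.
Definition areads (tp : tix -> atape) : tix -> option bool := fun i => aread (tp i).
Definition apply_acts (a : acts) (tp : tix -> atape) : tix -> atape :=
  fun i => amove (a i).2 (a i).1 (tp i).

(** [Call s] asks the oracle about the word at the head of tape [None] and
    resumes in [s]. [None] in place of a state leaves the module. *)
Variant outcome (S : Type) :=
| Go of option S & flags & acts
| Call of option S.

(** The flags are Boolean variables in the finite control. They are kept apart
    from the states because they are shared by all modules of a composition. *)
Record module := Module {
  mst :> finType;
  mstart : mst;
  mtr : mst -> flags -> (tix -> option bool) -> outcome mst
}.

Implicit Types (M : module) (O : set word) (m : memory).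

Definition answer (f : flags) (b : bool) : flags := updf f ans (f ans || b).

(** The last two arguments are the number of steps and the queries. *)
Inductive runs O M : option M -> memory -> option M -> memory -> nat -> seq word -> Prop :=
| runs_refl s m : runs O s m s m 0 [::]
| runs_go s f tp s1 f1 a s2 m2 t l :
    mtr s f (areads tp) = Go s1 f1 a ->
    runs O s1 (f1, apply_acts a tp) s2 m2 t l -> runs O (Some s) (f, tp) s2 m2 t.+1 l
| runs_call s f tp s1 s2 m2 t w l :
    mtr s f (areads tp) = Call s1 -> holds_word (tp None) w ->
    runs O s1 (answer f `[< O w >], tp) s2 m2 t l ->
    runs O (Some s) (f, tp) s2 m2 t.+1 (w :: l).

Definition terminates O M m m' t l := runs O (Some (mstart M)) m None m' t l.

Lemma runs_trans O M (s1 s2 s3 : option M) m1 m2 m3 t1 t2 l1 l2 :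
  runs O s1 m1 s2 m2 t1 l1 -> runs O s2 m2 s3 m3 t2 l2 ->
  runs O s1 m1 s3 m3 (t1 + t2) (l1 ++ l2).
Proof.
move=> H; elim: H => {s1 m1 s2 m2 t1 l1} [//|s f tp s1 f1 a s2 m2 t l e _ IH|s f tp s1 s2 m2 t w l e hw _ IH] H2.
  exact: runs_go e (IH H2).
exact: runs_call e hw (IH H2).
Qed.

Definition omapo (S S' : Type) (h : option S -> option S') (o : outcome S) :=
  match o with Go s f a => Go (h s) f a | Call s => Call (h s) end.

Definition route (S S' : Type) (h : S -> S') (k : option S') (o : option S) :=
  if o is Some s then Some (h s) else k.

(** [M1] is a part of [M2], with its exit wired to [k]. *)
Definition embedded M1 M2 (h : M1 -> M2) (k : option M2) :=
  forall s f rd, mtr (h s) f rd = omapo (route h k) (mtr s f rd).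

(** Every rule for composed modules is an instance of this one: a part runs
    inside a module as it does alone. *)
Lemma runs_embedded O M1 M2 (h : M1 -> M2) k : embedded h k ->
  forall s m s' m' t l, runs O s m s' m' t l -> runs O (route h k s) m (route h k s') m' t l.
Proof.
move=> E s m s' m' t l; elim=> {s m s' m' t l} [s m|s f tp s1 f1 a s2 m2 t l e _ IH|s f tp s1 s2 m2 t w l e hw _ IH].
- exact: runs_refl.
- by apply: runs_go IH; rewrite E e.
- by apply: runs_call hw IH; rewrite E e.
Qed.

Definition same_acts (rd : tix -> option bool) : acts := fun i => (rd i, Stay).

Lemma apply_same tp : apply_acts (same_acts (areads tp)) tp = tp.
Proof.
by apply/funext => i; rewrite /apply_acts /= /areads /aread upd_id; case: (tp i).
Qed.

Definition mact (g : flags -> (tix -> option bool) -> flags * acts) : module :=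
  @Module unit tt (fun _ f rd => Go None (g f rd).1 (g f rd).2).

Lemma mactP O g f tp :
  terminates O (mact g) (f, tp)
    ((g f (areads tp)).1, apply_acts (g f (areads tp)).2 tp) 1 [::].
Proof. by apply: runs_go => //; apply: runs_refl. Qed.

Definition mcall : module := @Module unit tt (fun _ _ _ => Call None).

Lemma mcallP O f tp w : holds_word (tp None) w ->
  terminates O mcall (f, tp) (answer f `[< O w >], tp) 1 [:: w].
Proof. by move=> hw; apply: runs_call hw _ => //; apply: runs_refl. Qed.

Definition mseq M1 M2 : module :=
  @Module (M1 + M2)%type (inl (mstart M1)) (fun s f rd =>
    match s with
    | inl s1 => omapo (route inl (Some (inr (mstart M2)))) (mtr s1 f rd)
    | inr s2 => omapo (route inr None) (mtr s2 f rd)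
    end).

Lemma mseqP O M1 M2 m m1 m2 t1 t2 l1 l2 :
  terminates O M1 m m1 t1 l1 -> terminates O M2 m1 m2 t2 l2 ->
  terminates O (mseq M1 M2) m m2 (t1 + t2) (l1 ++ l2).
Proof.
move=> H1 H2; apply: runs_trans.
  by apply: (@runs_embedded O M1 (mseq M1 M2) inl (Some (inr (mstart M2)))) H1.
by apply: (@runs_embedded O M2 (mseq M1 M2) inr None) H2.
Qed.

Definition test := flags -> (tix -> option bool) -> bool.

Definition mif (b : test) M1 M2 : module :=
  @Module (option (M1 + M2)) None (fun s f rd =>
    match s with
    | None => Go (Some (Some (if b f rd then inl (mstart M1) else inr (mstart M2))))
                 f (same_acts rd)
    | Some (inl s1) => omapo (route (Some \o inl) None) (mtr s1 f rd)
    | Some (inr s2) => omapo (route (Some \o inr) None) (mtr s2 f rd)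
    end).

Definition holds (b : test) m := b m.1 (areads m.2).

Lemma mifP O b M1 M2 m m' t l :
  terminates O (if holds b m then M1 else M2) m m' t l ->
  terminates O (mif b M1 M2) m m' t.+1 l.
Proof.
case: m => f tp; rewrite /holds /= => H; apply: runs_go => //.
rewrite apply_same; case: (b f _) H => H.
  by apply: (@runs_embedded O M1 (mif b M1 M2) (Some \o inl) None) H.
by apply: (@runs_embedded O M2 (mif b M1 M2) (Some \o inr) None) H.
Qed.

Definition mwhile (b : test) M : module :=
  @Module (option M) None (fun s f rd =>
    match s with
    | None => Go (if b f rd then Some (Some (mstart M)) else None) f (same_acts rd)
    | Some s => omapo (route Some (Some None)) (mtr s f rd)
    end).

Lemma mwhile_stop O b M m : ~~ holds b m -> terminates O (mwhile b M) m m 1 [::].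
Proof.
case: m => f tp nb; apply: runs_go => //.
by rewrite apply_same -[b f _]/(holds b (f, tp)) (negPf nb); apply: runs_refl.
Qed.

Lemma mwhile_step O b M m m1 m2 t1 t2 l1 l2 : holds b m ->
  terminates O M m m1 t1 l1 -> terminates O (mwhile b M) m1 m2 t2 l2 ->
  terminates O (mwhile b M) m m2 (t1 + t2).+1 (l1 ++ l2).
Proof.
case: m => f tp hb H1 H2; apply: runs_go => //.
rewrite apply_same -[b f _]/(holds b (f, tp)) hb; apply: runs_trans H2.
by apply: (@runs_embedded O M (mwhile b M) Some (Some None)) H1.
Qed.

(** [m_ i] is the memory after [i] iterations. *)
Lemma mwhile_iter O b M (m_ : nat -> memory) T n :
  (forall i, i < n -> holds b (m_ i) /\ terminates O M (m_ i) (m_ i.+1) T [::]) ->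
  ~~ holds b (m_ n) ->
  terminates O (mwhile b M) (m_ 0) (m_ n) (n * T.+1 + 1) [::].
Proof.
elim: n m_ => [|n IH] m_ Hs He; first exact: mwhile_stop.
have [//|hb H0] := Hs 0; rewrite mulSn.
have := IH (m_ \o succn) _ He; rewrite /comp => /(_ (fun i => Hs i.+1)) H.
rewrite (_ : _ + 1 = (T + (n * T.+1 + 1)).+1); last by lia.
exact: (mwhile_step hb H0 H).
Qed.

(** * From modules to oracle machines *)

Section Machine.
Variable M : module.

(** After a query an oracle machine is in one of two fixed states, wherever the
    query was asked. The machine therefore stores the state in which the module
    resumes, together with the flags, as one symbol on an additional tape. *)
Definition ret_symbol : finType := (option M * flags)%type.

Definition enc (b : option bool) : cell ret_symbol := omap inl b.
Definition dec (c : cell ret_symbol) : option bool :=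
  if c is Some (inl b) then Some b else None.

Lemma encK b : dec (enc b) = b. Proof. by case: b. Qed.

Definition tape_sim (a : atape) (t : tape ret_symbol) :=
  (forall i, nth None (tleft t) i = if i < hd a then enc (cont a (hd a - i.+1)) else None) /\
  (forall i, nth None (tright t) i = enc (cont a (hd a + i))).

Lemma read_sim a t : tape_sim a t -> dec (read t) = aread a.
Proof. by move=> [_ /(_ 0)]; rewrite /read -nth0 addn0 => ->; rewrite encK. Qed.

Lemma move_sim a t d b : tape_sim a t ->
  tape_sim (amove d b a) (move_head d (write (enc b) t)).
Proof.
case: a t => C q [L R] [/= HL HR].
have HR' i : nth None (behead R) i = enc (C (q + i.+1)) by rewrite nth_behead HR.
case: d => /=.
- case: q HL HR HR' => [|q] HL HR HR'; split=> i /=.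
  + by rewrite nth_behead HL.
  + case: i => [|[|i]] /=; first by rewrite -nth0 HL.
      by rewrite upd_eq.
    by rewrite HR'.
  + rewrite nth_behead HL ltnS; case: ltnP => // lt; congr enc.
    by rewrite subSS upd_neq //; lia.
  + case: i => [|[|i]] /=; first by rewrite -nth0 HL /= subSS subn0 addn0 upd_neq //; lia.
      by rewrite addn1 upd_eq.
    by rewrite HR' upd_neq; [congr enc; congr C; lia|lia].
- split=> i /=; first by rewrite HL; case: ltnP => // lt; rewrite upd_neq //; lia.
  by case: i => [|i] /=; [rewrite addn0 upd_eq|rewrite HR' upd_neq //; lia].
- split=> i /=.
    case: i => [|i] /=; first by rewrite subSS subn0 upd_eq.
    by rewrite HL ltnS subSS; case: ltnP => // lt; rewrite upd_neq //; lia.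
  by rewrite HR' upd_neq; [congr enc; congr C; lia|lia].
Qed.

Lemma tape_word_sim a t w : tape_sim a t -> holds_word a w -> tape_word t = w.
Proof.
case: a t => C q [L R] [/= _ HR]; rewrite /holds_word /= /tape_word /= => Hw.
have {HR Hw} H i : i <= size w -> nth None R i = enc (onth w i).
  by move=> iw; rewrite HR Hw.
elim: w R H => [|b w IH] [|c R] H //=.
- by move: (H 0 isT) => /= ->.
- by have := H 0 isT.
- have /= -> := H 0 isT; congr cons; apply: IH => i iw; exact: (H i.+1).
Qed.

Definition nt := #|reg|.+2.
Definition mtape (i : tix) : 'I_nt :=
  if i is Some r then lift ord0 (lift ord_max (enum_rank r)) else ord0.
Definition ret_tape : 'I_nt := lift ord0 ord_max.

Definition tape_case (T : Type) (a : tix -> T) (r : T) (i : 'I_nt) : T :=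
  if unlift ord0 i is Some j then
    if unlift ord_max j is Some k then a (Some (enum_val k)) else r
  else a None.

Lemma tape_case_mtape T (a : tix -> T) r i : tape_case a r (mtape i) = a i.
Proof. by case: i => [x|]; rewrite /tape_case /= ?liftK ?enum_rankK ?unlift_none. Qed.

Lemma tape_case_ret T (a : tix -> T) r : tape_case a r ret_tape = r.
Proof. by rewrite /tape_case /= liftK unlift_none. Qed.

Definition mstate : finType := ((option M * flags) + 'I_5)%type.
Definition q_ask : mstate := inr (inord 0).
Definition q_yes : mstate := inr (inord 1).
Definition q_no : mstate := inr (inord 2).
Definition q_acc : mstate := inr (inord 3).
Definition q_rej : mstate := inr (inord 4).

Definition keep (rd : {ffun 'I_nt -> cell ret_symbol}) : 'I_nt -> cell ret_symbol * move :=
  fun i => (rd i, Stay).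

Definition resume (b : bool) (rd : {ffun 'I_nt -> cell ret_symbol}) : mstate :=
  if rd ret_tape is Some (inr (s, f)) then inl (s, answer f b) else q_rej.

Definition mtrans (q : mstate) (rd : {ffun 'I_nt -> cell ret_symbol}) :
    mstate * ('I_nt -> cell ret_symbol * move) :=
  match q with
  | inl (Some s, f) =>
      match mtr s f (fun i => dec (rd (mtape i))) with
      | Go s' f' a =>
          (inl (s', f'), tape_case (fun i => (enc (a i).1, (a i).2)) (None, Stay))
      | Call s' =>
          (q_ask, tape_case (fun i => (rd (mtape i), Stay)) (Some (inr (s', f)), Stay))
      end
  | inl (None, f) => (if f ans then q_acc else q_rej, keep rd)
  | inr i => (if i == inord 1 then resume true rd else resume false rd, keep rd)
  end.

Definition machine_of : oracle_machine :=
  @OracleMachine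
    (@Machine nt ret_symbol mstate (inl (Some (mstart M), [ffun => false])) q_acc q_rej mtrans)
    ord0 q_ask q_yes q_no.

Notation MM := machine_of.

Definition sim (s : option M) (m : memory) (c : config MM) :=
  cstate c = inl (s, m.1) /\ forall i, tape_sim (m.2 i) (ctapes c (mtape i)).

Lemma inord5 i j : i < 5 -> j < 5 -> (inord i == inord j :> 'I_5) = (i == j).
Proof. by move=> i5 j5; rewrite -val_eqE /= !inordK. Qed.

Lemma inr_inord5 i j : i < 5 -> j < 5 ->
  (inr (inord i) == inr (inord j) :> mstate) = (i == j).
Proof.
move=> i5 j5; rewrite -(inord5 i5 j5); apply/eqP/eqP => [[]|->] //.
Qed.

Lemma halted_inl (c : config MM) p : cstate c = inl p -> halted c = false.
Proof. by rewrite /halted /accepting => ->. Qed.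

Lemma query_inl (c : config MM) p : cstate c = inl p -> query c = None.
Proof. by rewrite /query => e; rewrite (halted_inl e) e. Qed.

Lemma ostep_go O s f tp s1 f1 a (c : config MM) :
  sim (Some s) (f, tp) c -> mtr s f (areads tp) = Go s1 f1 a ->
  sim s1 (f1, apply_acts a tp) (ostep O c).
Proof.
move=> [es ht] e; rewrite /ostep (query_inl es) /step (halted_inl es) es /=.
have -> : (fun i => dec ([ffun i => read (ctapes c i)] (mtape i))) = areads tp.
  by apply/funext => i; rewrite ffunE; apply: read_sim; apply: ht.
rewrite e; split=> // i; rewrite /= ffunE tape_case_mtape /=; exact: move_sim.
Qed.

Lemma tape_sim_stay a (t : tape ret_symbol) :
  tape_sim a t -> tape_sim a (move_head Stay (write (read t) t)).
Proof.
case: a t => C q [L R] [/= HL HR]; split=> //= i; rewrite -HR /read /=.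
by case: R {HR} => [|x R] //=; case: i => //= i; rewrite nth_nil.
Qed.

Lemma ostep_call O s f tp s1 w (c : config MM) :
  sim (Some s) (f, tp) c -> mtr s f (areads tp) = Call s1 ->
  holds_word (tp None) w ->
  [/\ query (ostep O c) = Some w, query (ostep O (ostep O c)) = None &
      sim s1 (answer f `[< O w >], tp) (ostep O (ostep O (ostep O c)))].
Proof.
move=> [es ht] e hw.
have [q1 [rt1 ht1]] : cstate (ostep O c) = q_ask /\
    read (ctapes (ostep O c) ret_tape) = Some (inr (s1, f)) /\
    forall i, tape_sim (tp i) (ctapes (ostep O c) (mtape i)).
  rewrite /ostep (query_inl es) /step (halted_inl es) es /=.
  have -> : (fun i => dec ([ffun i => read (ctapes c i)] (mtape i))) = areads tp.
    by apply/funext => i; rewrite ffunE; apply: read_sim; apply: ht.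
  rewrite e; split=> //=; rewrite ffunE tape_case_ret; split=> // i.
  by rewrite !ffunE tape_case_mtape ffunE; apply/tape_sim_stay/ht.
move: (ostep O c) q1 rt1 ht1 => c1 q1 rt1 ht1.
have nh b : halted (@Config MM b (ctapes c1)) = (b == q_acc) || (b == q_rej) by [].
have Q1 : query c1 = Some w.
  rewrite /query /halted /accepting q1 /= !inr_inord5 //=.
  by rewrite (tape_word_sim (ht1 None) hw).
split=> //; first by rewrite {1}/ostep Q1 /query /halted /accepting; case: asboolP => _; rewrite /= !inr_inord5 ?andbF.
set c2 := ostep O c1.
have [e2 t2] : cstate c2 = (if `[< O w >] then q_yes else q_no) /\ ctapes c2 = ctapes c1.
  by rewrite /c2 /ostep Q1.
have Q2 : query c2 = None.
  by rewrite /query /halted /accepting e2; case: (asbool _); rewrite /= !inr_inord5 ?andbF.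
have H2 : halted c2 = false.
  by rewrite /halted /accepting e2; case: (asbool _); rewrite /= !inr_inord5.
rewrite /ostep Q2 /step H2 e2 t2.
have R b : resume b [ffun i => read (ctapes c1 i)] = inl (s1, answer f b).
  by rewrite /resume ffunE rt1.
split=> [|i]; last by case: (asbool _); rewrite /= ffunE /= ?ffunE; apply/tape_sim_stay/ht1.
by case: (asbool _); rewrite /= inord5 //= R.
Qed.

Definition asked O (c : config MM) t w := exists2 k, k < t & query (iter k (ostep O) c) = Some w.

(** A transition of the module takes one step of the machine, and a call takes
    three: store the return state, ask, resume. *)
Lemma sim_runs O s m s' m' t l : runs O s m s' m' t l ->
  forall c : config MM, sim s m c ->
  exists t', [/\ t' <= 3 * t, sim s' m' (iter t' (ostep O) c) &
    forall w, asked O c t' w <-> w \in l].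
Proof.
have iterS_ n (x : config MM) : iter n (ostep O) (ostep O x) = iter n.+1 (ostep O) x.
  by rewrite iterSr.
elim=> {s m s' m' t l} [s m|s f tp s1 f1 a s2 m2 t l e _ IH|s f tp s1 s2 m2 t w l e hw _ IH] c hs.
- by exists 0; split=> // w; split=> // -[].
- have [t' [le hs' hq]] := IH _ (ostep_go O hs e).
  exists t'.+1; split; [by lia|by rewrite iterSr|].
  move=> w; rewrite -hq; split=> [[[|k] lt]|[k lt E]]; last by exists k.+1; rewrite // iterSr.
    by rewrite /= (query_inl hs.1).
  by rewrite iterSr => E; exists k.
- have [Q1 Q2 hs3] := ostep_call O hs e hw.
  have [t' [le hs' hq]] := IH _ hs3.
  exists t'.+3; split; [by lia|by rewrite !iterSr|].
  move=> w'; rewrite inE; split=> [[[|[|[|k]]] lt]|/orP[/eqP ->|]].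
  + by rewrite /= (query_inl hs.1).
  + by rewrite [iter _ _ _]/= Q1 => -[->]; rewrite eqxx.
  + by rewrite [iter _ _ _]/= Q2.
  + by rewrite !iterSr => E; apply/orP; right; apply/hq; exists k.
  + by exists 1.
  + by move/hq => [k lt E]; exists k.+3; rewrite // !iterSr.
Qed.

Definition input_mem (x : word) : memory :=
  ([ffun => false],
   fun i => if i is Some _ then ATape (fun _ => None) 1
            else ATape (fun j => if j is j'.+1 then onth x j' else None) 1).

Lemma sim_init x : sim (Some (mstart M)) (input_mem x) (init MM [:: x]).
Proof.
split=> //= -[r|]; rewrite /= ffunE /=; split=> i /=.
- by rewrite nth_nil; case: ifP.
- by rewrite !nth_nil.
- by case: i => [|i]; rewrite /= ?nth_nil.
- by rewrite (map_comp Some inl) -onthE onth_map.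
Qed.

Lemma halted_ostep O (c : config MM) : halted c -> ostep O c = c.
Proof. by move=> h; rewrite /ostep /query h /step h. Qed.

Lemma halted_iter O (c : config MM) n : halted c -> iter n (ostep O) c = c.
Proof. by move=> h; elim: n => //= n ->; apply: halted_ostep. Qed.

(** The machine halts one step after the module has been left, and halted
    configurations do not change, so no query is missed or added. *)
Theorem machine_ofP O x m' t l : terminates O M (input_mem x) m' t l ->
  [/\ forall k, 3 * t < k -> halted (orun MM O x k),
      oaccepts MM O x <-> m'.1 ans &
      forall w, queries MM O x w <-> w \in l].
Proof.
move=> H; have [t' [le [e _] hq]] := sim_runs H (sim_init x).
have eR k : orun MM O x k = iter k (ostep O) (init MM [:: x]) by [].
set cf := iter t' _ _ in e.
have E1 : cstate (ostep O cf) = if m'.1 ans then q_acc else q_rej.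
  by rewrite /ostep (query_inl e) /step (halted_inl e) e.
have hh : halted (ostep O cf).
  by rewrite /halted /accepting E1; case: ifP => _ /=; rewrite eqxx ?orbT.
have late k : t' < k -> orun MM O x k = ostep O cf.
  move=> lt; have -> : k = (k - t'.+1) + t'.+1 by lia.
  by rewrite eR iterD; apply: halted_iter.
split=> [k lt||w].
- by rewrite late //; lia.
- split=> [[k]|a]; last first.
    by exists t'.+1; rewrite late // /accepting E1 a.
  move=> acc; have hk : halted (orun MM O x k) by rewrite /halted acc.
  have : accepting (orun MM O x (t'.+1 + k)).
    by rewrite eR iterD -/(orun MM O x k) halted_iter.
  rewrite late; last by lia.
  by rewrite /accepting E1; case: ifP => //= _; rewrite inr_inord5.
- split=> [[k Q]|/hq[k _ Q]]; last by exists k.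
  apply/hq; exists k => //; rewrite ltnNge; apply/negP => le'.
  case: (ltnP t' k) => [lt|ge].
    by move: Q; rewrite late // /query hh.
  have ek : k = t' by lia.
  by move: Q; rewrite ek eR -/cf (query_inl e).
Qed.

End Machine.
End Modules.

(** * Loop programs *)
Section Programs.
Variables (reg flag : finType) (ans : flag).
Local Notation flags := (flags flag).
Local Notation tix := (option reg).
Local Notation memory := (memory reg flag).
Local Notation module := (module reg flag).
Local Notation term O := (@terminates reg flag ans O).

(** [CFor r c] runs [c] for [r] from 0 to N - 1, and [CUpto r z c] runs [c] as
    often as the value of [r], where [z] is an auxiliary register. No other loop
    is available, which makes every program run in polynomial time. *)
Inductive cmd :=
| CFlag of flags -> option bool -> flags
| CRight
| CLeft
| CHome
| CWrite of bool
| CAsk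
| CSeq of cmd & cmd
| CIf of flag & cmd & cmd
| CFor of reg & cmd
| CUpto of reg & reg & cmd.

Record st := St {
  sflag : flags;
  sword : word;
  spos : nat;
  sreg : reg -> nat;
  slog : seq word
}.

Definition set_flags f s := St f (sword s) (spos s) (sreg s) (slog s).
Definition set_word w s := St (sflag s) w (spos s) (sreg s) (slog s).
Definition set_pos p s := St (sflag s) (sword s) p (sreg s) (slog s).
Definition set_reg r v s := St (sflag s) (sword s) (spos s) (upd (sreg s) r v) (slog s).
Definition ask_oracle (O : set word) w s :=
  St (answer ans (sflag s) `[< O w >]) (sword s) (spos s) (sreg s) (rcons (slog s) w).

Definition scell s := onth (sword s) (spos s).

Section Denotation.
Variables (O : set word) (N : nat).

Definition inc_reg r s := set_reg r (minn N (sreg s r).+1) s.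
Definition dec_reg r s := set_reg r (sreg s r).-1 s.

(** The value of a register is a head position, hence can only be consumed step
    by step. [CUpto] moves it from [r] to [z] and back. *)
Definition drain r z (f : st -> st) s :=
  iter (sreg s r) (fun s => f (inc_reg z (dec_reg r s))) s.

Fixpoint den (c : cmd) (s : st) : st :=
  match c with
  | CFlag g => set_flags (g (sflag s) (scell s)) s
  | CRight => if scell s is Some _ then set_pos (spos s).+1 s else s
  | CLeft => set_pos (spos s).-1 s
  | CHome => set_pos 0 s
  | CWrite b => if scell s is Some _ then set_word (set_nth false (sword s) (spos s) b) s else s
  | CAsk => ask_oracle O (drop (spos s) (sword s)) s
  | CSeq c1 c2 => den c2 (den c1 s)
  | CIf f c1 c2 => if sflag s f then den c1 s else den c2 s
  | CFor r c => set_reg r 0 (iter N (fun s => inc_reg r (den c s)) (set_reg r 0 s))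
  | CUpto r z c => drain z r id (drain r z (den c) (set_reg z 0 s))
  end.
End Denotation.

(** [CUpto r z c] restores [r], so [r] does not count as modified: the loop of a
    quantifier contains atoms that depend on the quantified variable. *)
Fixpoint modifies (c : cmd) : seq reg :=
  match c with
  | CSeq c1 c2 | CIf _ c1 c2 => modifies c1 ++ modifies c2
  | CFor r c => r :: modifies c
  | CUpto _ z c => z :: modifies c
  | _ => [::]
  end.

(** Loops are driven by the head of their register, which must be at the same
    place before and after each execution of the body. *)
Fixpoint proper_cmd (c : cmd) : bool :=
  match c with
  | CSeq c1 c2 | CIf _ c1 c2 => proper_cmd c1 && proper_cmd c2
  | CFor r c => (r \notin modifies c) && proper_cmd c
  | CUpto r z c => [&& r != z, r \notin modifies c, z \notin modifies c & proper_cmd c]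
  | _ => true
  end.

Definition bounded N s := forall r, sreg s r <= N.

Lemma bounded_set N r v s : v <= N -> bounded N s -> bounded N (set_reg r v s).
Proof. by move=> le h q; rewrite /= /upd; case: eqP. Qed.

Lemma bounded_inc N r s : bounded N s -> bounded N (inc_reg N r s).
Proof. exact/bounded_set/geq_minl. Qed.

Lemma bounded_dec N r s : bounded N s -> bounded N (dec_reg r s).
Proof. by move=> h; apply: bounded_set => //; apply: leq_trans (leq_pred _) (h r). Qed.

Lemma drainP N r z (f : st -> st) s : r != z -> bounded N s ->
  (forall s, bounded N s -> [/\ bounded N (f s), sreg (f s) r = sreg s r &
                               sreg (f s) z = sreg s z]) ->
  forall i, i <= sreg s r ->
  let s' := iter i (fun s => f (inc_reg N z (dec_reg r s))) s in
  [/\ bounded N s', sreg s' r = sreg s r - i & sreg s' z = minn N (sreg s z + i)].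
Proof.
move=> nrz bs hf; elim=> [|i IH] lt /=.
  by rewrite subn0 addn0; split=> //; rewrite (minn_idPr (bs z)).
have [b er ez] := IH (ltnW lt).
have [] := hf _ (bounded_inc z (bounded_dec r b)).
move=> b' -> ->; split=> //.
  by rewrite /= upd_neq // upd_eq er; lia.
by rewrite /= upd_eq upd_neq 1?eq_sym // ez; lia.
Qed.

(** The bound is needed for the registers restored by [CUpto], since increments
    stop at [N]. *)
Lemma modifiesP O N c s : proper_cmd c -> bounded N s ->
  bounded N (den O N c s) /\
  forall r, r \notin modifies c -> sreg (den O N c s) r = sreg s r.
Proof.
elim: c s => [g||||b||c1 IH1 c2 IH2|f c1 IH1 c2 IH2|q c IH|q z c IH] s //=.
- by case: (scell s).
- by case: (scell s).
- move=> /andP[p1 p2] bs; have [b1 h1] := IH1 s p1 bs; have [b2 h2] := IH2 _ p2 b1.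
  by split=> // r; rewrite mem_cat negb_or => /andP[n1 n2]; rewrite h2 // h1.
- move=> /andP[p1 p2] bs; have [b1 h1] := IH1 s p1 bs; have [b2 h2] := IH2 _ p2 bs.
  by case: ifP => _; split=> // r; rewrite mem_cat negb_or => /andP[n1 n2]; rewrite ?h1 ?h2.
- move=> /andP[nq pc] bs.
  have H k : let s' := iter k (fun s => inc_reg N q (den O N c s)) (set_reg q 0 s) in
    bounded N s' /\ forall r, r \notin q :: modifies c -> sreg s' r = sreg s r.
    elim: k => [|k [b h]] /=.
      by split=> [|r]; [exact: bounded_set|rewrite inE negb_or => /andP[n1 n2]; rewrite upd_neq].
    have [b' h'] := IH _ pc b; split; first exact: bounded_inc.
    move=> r nr; move: (nr); rewrite inE negb_or => /andP[n1 n2].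
    by rewrite upd_neq // h' // h.
  have [b h] := H N; split=> [|r nr]; first exact: bounded_set.
  by rewrite upd_neq ?h //; move: nr; rewrite inE negb_or => /andP[].
- move=> /and4P[nqz nq nz pc] bs.
  have bs0 : bounded N (set_reg z 0 s) by exact: bounded_set.
  have hf s' : bounded N s' -> [/\ bounded N (den O N c s'), sreg (den O N c s') q = sreg s' q &
      sreg (den O N c s') z = sreg s' z].
    by move=> b; have [b' h] := IH _ pc b; rewrite !h.
  have [b1 eq1 ez1] := drainP nqz bs0 hf (leqnn _).
  have nzq : z != q by rewrite eq_sym.
  have hid s' : bounded N s' -> [/\ bounded N (id s'), sreg (id s') z = sreg s' z &
      sreg (id s') q = sreg s' q] by [].
  have [b2 ez2 eq2] := drainP nzq b1 hid (leqnn _).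
  split=> [|r]; first exact: b2.
  rewrite inE negb_or => /andP[nrz nr]; case: (eqVneq r q) => [->|nrq].
    rewrite [LHS]eq2 eq1 ez1 /= upd_eq upd_neq // subnn !add0n.
    by rewrite (minn_idPr (bs q)) (minn_idPr (bs q)).
  have keep (f : st -> st) u v k s' : (forall s, bounded N s -> bounded N (f s) /\ sreg (f s) r = sreg s r) ->
      r != u -> r != v -> bounded N s' ->
      let s'' := iter k (fun s => f (inc_reg N v (dec_reg u s))) s' in
      bounded N s'' /\ sreg s'' r = sreg s' r.
    move=> h nu nv b'; elim: k => //= k [b3 e3].
    have [b4 e4] := h _ (bounded_inc v (bounded_dec u b3)).
    by split; [exact: b4|rewrite e4 /= !upd_neq].
  have [||||b3 e3] := keep (den O N c) q z (sreg (set_reg z 0 s) q) (set_reg z 0 s) => //.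
    by move=> s' b'; have [b4 h4] := IH _ pc b'; rewrite h4.
  have [||||b5 e5] := keep id z q (sreg (drain N q z (den O N c) (set_reg z 0 s)) z) (drain N q z (den O N c) (set_reg z 0 s)) => //.
  by rewrite [LHS]e5 [LHS]e3 /= upd_neq.
Qed.

(** ** Compilation *)

Definition act_on (i : tix) (d : move) (b : option bool) (rd : tix -> option bool) : acts reg :=
  upd (same_acts rd) i (b, d).

Lemma act_onE i d b (tp : tix -> atape) :
  apply_acts (act_on i d b (areads tp)) tp = upd tp i (amove d b (tp i)).
Proof.
apply/funext => j; rewrite /apply_acts /act_on /upd; case: eqP => [->//|_].
exact: (congr1 (@^~ j) (apply_same tp)).
Qed.

Definition mmove (i : tix) (d : move) : module :=
  mact (fun f rd => (f, act_on i d (rd i) rd)).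

Lemma mmoveP O f tp i d :
  term O (mmove i d) (f, tp) (f, upd tp i (amove d (aread (tp i)) (tp i))) 1 [::].
Proof. by rewrite -act_onE; apply: mactP. Qed.

Definition mskip : module := mact (fun f rd => (f, same_acts rd)).

Lemma mskipP O m : term O mskip m m 1 [::].
Proof. by case: m => f tp; rewrite -{2}(apply_same tp); apply: mactP. Qed.

Definition on_cell (i : tix) (p : pred (option bool)) : test reg flag := fun _ rd => p (rd i).

(** The start of the word is recognized by the blank cell to its left. *)
Definition mhome : module :=
  mseq (mmove None MoveLeft)
    (mseq (mwhile (on_cell None isSome) (mmove None MoveLeft)) (mmove None MoveRight)).

Definition mrewind r : module :=
  mwhile (on_cell (Some r) (predC1 (Some false))) (mmove (Some r) MoveLeft).

Definition mdrain r z M : module :=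
  mwhile (on_cell (Some r) (predC1 (Some false)))
    (mseq (mmove (Some r) MoveLeft)
      (mseq (mif (on_cell (Some z) isSome) (mmove (Some z) MoveRight) mskip) M)).

Fixpoint module_of (c : cmd) : module :=
  match c with
  | CFlag g => mact (fun f rd => (g f (rd None), same_acts rd))
  | CRight => mif (on_cell None isSome) (mmove None MoveRight) mskip
  | CLeft => mseq (mmove None MoveLeft)
      (mif (on_cell None (pred1 None)) (mmove None MoveRight) mskip)
  | CHome => mhome
  | CWrite b => mif (on_cell None isSome)
      (mact (fun f rd => (f, act_on None Stay (Some b) rd))) mskip
  | CAsk => mcall reg flag
  | CSeq c1 c2 => mseq (module_of c1) (module_of c2)
  | CIf f c1 c2 => mif (fun g _ => g f) (module_of c1) (module_of c2)
  | CFor r c => mseq (mrewind r) (mseq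
      (mwhile (on_cell (Some r) isSome) (mseq (module_of c) (mmove (Some r) MoveRight)))
      (mrewind r))
  | CUpto r z c => mseq (mrewind z) (mseq (mdrain r z (module_of c)) (mdrain z r mskip))
  end.

Fixpoint cost (c : cmd) (L : nat) : nat :=
  match c with
  | CRight | CWrite _ => 2
  | CLeft => 3
  | CHome => 2 * L + 6
  | CFlag _ | CAsk => 1
  | CSeq c1 c2 => cost c1 L + cost c2 L
  | CIf _ c1 c2 => (cost c1 L + cost c2 L).+1
  | CFor _ c => L * (cost c L + 2) + 4 * L + 3
  | CUpto _ _ c => L * (cost c L + 4) + 7 * L + 3
  end.

Lemma onth_set_nth (w : word) p b : p < size w ->
  onth (set_nth false w p b) = upd (onth w) p (Some b).
Proof.
move=> lt; apply/funext => j; rewrite /upd !onthE.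
have sz : size (set_nth false w p b) = size w by rewrite size_set_nth; apply/maxn_idPr.
case: (ltnP j (size w)) => le.
  by rewrite !(nth_map false) ?sz // nth_set_nth /=; case: eqP.
by rewrite !nth_default ?size_map ?sz //; case: eqP => // e; move: le; rewrite e leqNgt lt.
Qed.

Section Correctness.
Variables (O : set word) (N L : nat).
Hypothesis (N_gt0 : 0 < N) (N_le : N <= L).

Definition wcont (x : word) : nat -> option bool :=
  fun j => if j is j'.+1 then onth x j' else None.
(** The tape of a register has [N] symbols, and its value is the number of
    symbols left of the head. The first symbol differs from the others, so
    that the value 0 can be recognized. *)
Definition rcont : nat -> option bool :=
  fun j => if j == 1 then Some false else if 1 < j <= N then Some true else None.

Definition tapes_of s : tix -> atape := fun i =>
  if i is Some r then ATape rcont (sreg s r).+1 else ATape (wcont (sword s)) (spos s).+1.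
Definition mem_of s : memory := (sflag s, tapes_of s).

Definition wf s := [/\ size (sword s) = L, spos s <= L & forall r, sreg s r <= N].

Lemma amove_same d C q :
  amove d (C q) (ATape C q) =
  match d with
  | MoveRight => ATape C q.+1
  | Stay => ATape C q
  | MoveLeft => if q is q'.+1 then ATape C q' else
      ATape (fun j => if j is j'.+1 then C j' else None) 0
  end.
Proof. by rewrite /amove /= upd_id. Qed.

Lemma tapes_set_reg r v s :
  upd (tapes_of s) (Some r) (ATape rcont v.+1) = tapes_of (set_reg r v s).
Proof.
apply/funext => -[q|]; rewrite /upd //=; case: eqP => [[->]|]; rewrite /upd ?eqxx //.
by move=> n; case: eqP => // e; case: n; rewrite e.
Qed.

Lemma tapes_set_pos p s :
  upd (tapes_of s) None (ATape (wcont (sword s)) p.+1) = tapes_of (set_pos p s).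
Proof. by apply/funext => -[q|]. Qed.

Lemma move_reg r d v s :
  (match d with MoveRight => v = (sreg s r).+1 | Stay => False | MoveLeft => sreg s r = v.+1 end) ->
  term O (mmove (Some r) d) (mem_of s) (mem_of (set_reg r v s)) 1 [::].
Proof.
move=> H; rewrite /mem_of /= -tapes_set_reg.
have -> : ATape rcont v.+1 = amove d (aread (tapes_of s (Some r))) (tapes_of s (Some r)).
  by rewrite amove_same /=; case: d H => // ->.
exact: mmoveP.
Qed.

Lemma move_word d p s :
  (match d with MoveRight => p = (spos s).+1 | Stay => False | MoveLeft => spos s = p.+1 end) ->
  term O (mmove None d) (mem_of s) (mem_of (set_pos p s)) 1 [::].
Proof.
move=> H; rewrite /mem_of /= -tapes_set_pos.
have -> : ATape (wcont (sword s)) p.+1 = amove d (aread (tapes_of s None)) (tapes_of s None).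
  by rewrite amove_same /=; case: d H => // ->.
exact: mmoveP.
Qed.

Lemma rcontS v : rcont v.+1 = if v < N then Some (v != 0) else None.
Proof. by case: v => [|v]; rewrite /rcont //= N_gt0. Qed.

Lemma set_reg_id r s : set_reg r (sreg s r) s = s.
Proof. by case: s => f w p g l; rewrite /set_reg /= upd_id. Qed.

Lemma set_reg2 r u v s : set_reg r u (set_reg r v s) = set_reg r u s.
Proof. by rewrite /set_reg /= upd_upd. Qed.

Lemma rewindP r s : sreg s r <= N ->
  term O (mrewind r) (mem_of s) (mem_of (set_reg r 0 s)) (sreg s r * 2 + 1) [::].
Proof.
move=> le; pose v := sreg s r.
have := @mwhile_iter reg flag ans O (on_cell (Some r) (predC1 (Some false)))
   (mmove (Some r) MoveLeft) (fun i => mem_of (set_reg r (v - i) s)) 1 v.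
rewrite subn0 subnn set_reg_id; apply.
- move=> i iv; split.
    rewrite /holds /on_cell /areads /aread /= upd_eq rcontS; case: ifP => //= _.
    by rewrite -lt0n subn_gt0 iv.
  rewrite -[set_reg r (v - i.+1) s](set_reg2 _ _ (v - i)).
  by apply: move_reg; rewrite /= upd_eq; lia.
- by rewrite /holds /on_cell /areads /aread /= upd_eq rcontS N_gt0.
Qed.

Lemma scell_lt s : wf s -> isSome (scell s) = (spos s < L).
Proof. by case=> e _ _; rewrite /scell onthTE e. Qed.

(** For [q = 0] the head is on the blank cell left of the word, which is not the
    memory of any state of a program. *)
Definition head_at s q : memory :=
  (sflag s, upd (tapes_of s) None (ATape (wcont (sword s)) q)).

Lemma leave_word s : term O (mmove None MoveLeft) (mem_of s) (head_at s (spos s)) 1 [::].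
Proof.
rewrite /head_at -[ATape _ _](amove_same MoveLeft (wcont (sword s)) (spos s).+1).
exact: mmoveP.
Qed.

Lemma enter_word s : term O (mmove None MoveRight) (head_at s 0) (mem_of (set_pos 0 s)) 1 [::].
Proof.
rewrite /mem_of -tapes_set_pos -(upd_upd _ _ (ATape (wcont (sword s)) 0)).
rewrite -[X in upd _ _ X](amove_same MoveRight (wcont (sword s)) 0).
exact: mmoveP.
Qed.

Lemma homeP s : wf s ->
  term O mhome (mem_of s) (mem_of (set_pos 0 s)) (spos s * 2 + 3) [::].
Proof.
move=> [sz le _]; pose p := spos s.
have := @mwhile_iter reg flag ans O (on_cell None isSome)
   (mmove None MoveLeft) (fun i => head_at s (p - i)) 1 p.
rewrite subn0 subnn => H; have {}H : term O (mwhile (on_cell None isSome) (mmove None MoveLeft))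
    (head_at s p) (head_at s 0) (p * 2 + 1) [::].
  apply: H => [i iv|//]; split.
    rewrite /holds /on_cell /areads /aread /=.
    case E : (p - i) => [|j] /=; first by lia.
    by rewrite onthTE sz; lia.
  rewrite /head_at -(upd_upd _ _ (ATape (wcont (sword s)) (p - i)) (ATape _ (p - i.+1))).
  have -> : p - i = (p - i.+1).+1 by lia.
  rewrite -[X in upd (upd _ _ _) _ X](amove_same MoveLeft (wcont (sword s)) (p - i.+1).+1).
  exact: mmoveP.
rewrite (_ : _ + 3 = 1 + ((p * 2 + 1) + 1)); last by rewrite -/p; lia.
exact: (mseqP (leave_word s) (mseqP H (enter_word s))).
Qed.

(** The module of [c] computes the denotation of [c], and asks the queries that
    it logs, within the cost of [c]. *)
Definition compiles c s := wf (den O N c s) /\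
  exists t l, [/\ t <= cost c L, slog (den O N c s) = slog s ++ l &
    term O (module_of c) (mem_of s) (mem_of (den O N c s)) t l].

Lemma mwhile_st b M (f : st -> st) T n s :
  (forall i, i < n -> let s' := iter i f s in holds b (mem_of s') /\
    exists t l, [/\ t <= T, slog (f s') = slog s' ++ l &
      term O M (mem_of s') (mem_of (f s')) t l]) ->
  ~~ holds b (mem_of (iter n f s)) ->
  exists t l, [/\ t <= n * T.+1 + 1, slog (iter n f s) = slog s ++ l &
    term O (mwhile b M) (mem_of s) (mem_of (iter n f s)) t l].
Proof.
elim: n s => [|n IH] s Hs He.
  by exists 1, [::]; rewrite cats0; split=> //; apply: mwhile_stop.
have [hb [t0 [l0 [le0 e0 H0]]]] := Hs 0 isT.
have [|t [l [le e H]]] := IH (f s) _ ltac:(rewrite -iterSr; exact: He).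
  by move=> i lt; rewrite -iterSr; apply: (Hs i.+1).
exists (t0 + t).+1, (l0 ++ l); split; first by rewrite mulSn; lia.
  by rewrite iterSr e e0 catA.
by rewrite iterSr; exact: mwhile_step hb H0 H.
Qed.

Lemma wf_bounded s : wf s -> bounded N s. Proof. by case. Qed.

Lemma wf_inc r s : wf s -> wf (inc_reg N r s).
Proof. by case=> h1 h2 h3; split=> //; apply: bounded_inc. Qed.

Lemma wf_set r v s : v <= N -> wf s -> wf (set_reg r v s).
Proof. by move=> le [h1 h2 h3]; split=> //; apply: bounded_set. Qed.

Lemma mdrainP r z (f : st -> st) M T s : r != z -> wf s ->
  (forall s, wf s -> [/\ wf (f s), sreg (f s) r = sreg s r, sreg (f s) z = sreg s z &
     exists t l, [/\ t <= T, slog (f s) = slog s ++ l &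
       term O M (mem_of s) (mem_of (f s)) t l]]) ->
  wf (drain N r z f s) /\
  exists t l, [/\ t <= L * (T + 4) + 1, slog (drain N r z f s) = slog s ++ l &
    term O (mdrain r z M) (mem_of s) (mem_of (drain N r z f s)) t l].
Proof.
move=> nrz ws hf; have [h1 h2 h3] := ws.
pose g s := f (inc_reg N z (dec_reg r s)).
have wd s' : wf s' -> wf (dec_reg r s').
  by move=> w'; apply: wf_set => //; case: w' => _ _ /(_ r); lia.
have wdi s' : wf s' -> wf (inc_reg N z (dec_reg r s')) by move=> /wd; apply: wf_inc.
have I i : i <= sreg s r -> wf (iter i g s) /\ sreg (iter i g s) r = sreg s r - i.
  elim: i => [|i IHi] le; first by rewrite subn0.
  have [w e] := IHi (ltnW le); have [w' er _ _] := hf _ (wdi _ w).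
  by split; rewrite iterS //= er /= upd_neq // upd_eq e; lia.
have [||t2 [l2 [le2 e2 H2]]] := @mwhile_st (on_cell (Some r) (predC1 (Some false)))
  (mseq (mmove (Some r) MoveLeft)
        (mseq (mif (on_cell (Some z) isSome) (mmove (Some z) MoveRight) mskip) M))
  g T.+3 (sreg s r) s.
+ move=> i lt s'; have [w e] := I i (ltnW lt); split.
    rewrite /holds /on_cell /areads /aread /= e rcontS; case: ifP => //= _.
    by rewrite -lt0n subn_gt0 lt.
  have [_ _ _ [t [l [le el H]]]] := hf _ (wdi _ w).
  exists (1 + (2 + t)), ([::] ++ ([::] ++ l)); split; [by lia|by rewrite el|].
  apply: mseqP; first by apply: (@move_reg r MoveLeft (sreg s' r).-1); rewrite e; lia.
  apply: mseqP H; apply: mifP.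
  have hz : holds (on_cell (Some z) isSome) (mem_of (set_reg r (sreg s' r).-1 s')) = (sreg (dec_reg r s') z < N).
    by rewrite /holds /on_cell /areads /aread /= rcontS; case: ifP.
  rewrite hz; case: ifP => lz.
    by apply: move_reg; apply/minn_idPr.
  have -> : inc_reg N z (dec_reg r s') = dec_reg r s'.
    rewrite /inc_reg (_ : minn N _ = sreg (dec_reg r s') z) ?set_reg_id //.
    have : sreg (dec_reg r s') z <= N by case: (wd _ w).
    by lia.
  exact: mskipP.
+ have [_ e] := I _ (leqnn _).
  by rewrite /holds /on_cell /areads /aread /= e subnn rcontS N_gt0.
have [w e] := I _ (leqnn _).
split=> //; exists t2, l2; split=> //.
have : sreg s r * T.+4 <= L * T.+4 by rewrite leq_mul2r (leq_trans (h3 r)) ?orbT.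
by rewrite addn4; lia.
Qed.

Theorem module_ofP c s : proper_cmd c -> wf s -> compiles c s.
Proof.
elim: c s => [g||||b||c1 IH1 c2 IH2|f c1 IH1 c2 IH2|r c IH|r z c IH] s /= pr ws.
- split; first by case: ws.
  exists 1, [::]; rewrite cats0; split=> //.
  have := mactP ans O (fun f rd => (g f (rd None), @same_acts reg rd)) (sflag s) (tapes_of s).
  by rewrite apply_same.
- have lt := scell_lt ws.
  have hs : holds (on_cell None isSome) (mem_of s) = isSome (scell s) by [].
  rewrite /compiles /=; case E : (scell s) lt hs => [b|] /= lt hs.
    split; first by case: ws.
    exists 2, [::]; rewrite cats0; split=> //.
    by apply: mifP; rewrite hs; apply: move_word.
  split=> //; exists 2, [::]; rewrite cats0; split=> //.
  by apply: mifP; rewrite hs; apply: mskipP.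
- split; first by case: ws => h1 h2 h3; split=> //=; lia.
  exists 3, [::]; rewrite cats0; split=> //=.
  case E : (spos s) => [|p]; last first.
    apply: (@mseqP _ _ _ _ _ _ _ (mem_of (set_pos p s)) _ 1 2 [::] [::]).
      by apply: (@move_word MoveLeft).
    apply: mifP; rewrite (_ : holds _ _ = false); first exact: mskipP.
    rewrite /holds /on_cell /areads /aread /= -[_ == _]negbK; apply/negbTE; rewrite negbK.
    have : isSome (onth (sword s) p) by case: ws => h1 h2 h3; rewrite onthTE h1 -E.
    by case: onth.
  have := leave_word s; rewrite E => H0; apply: mseqP H0 _; apply: mifP.
  by rewrite (_ : holds _ _ = true) //; exact: enter_word.
- split; first by case: ws.
  exists (spos s * 2 + 3), [::]; rewrite cats0; split=> //=; last exact: homeP.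
  by case: ws => _ h _; lia.
- have lt := scell_lt ws.
  have hs : holds (on_cell None isSome) (mem_of s) = isSome (scell s) by [].
  rewrite /compiles /=; case E : (scell s) lt hs => [b'|] /= lt hs.
    case: ws => h1 h2 h3; split.
      by split=> //=; rewrite size_set_nth h1; apply/maxn_idPr; rewrite -lt.
    exists 2, [::]; rewrite cats0; split=> //.
    apply: mifP; rewrite hs.
    have := mactP ans O (fun f rd => (f, act_on None Stay (Some b) rd)) (sflag s) (tapes_of s).
    rewrite act_onE /= /mem_of; congr (term _ _ _ (_, _) _ _).
    apply/funext => -[q|] //=; congr ATape; apply/funext => -[|j] //=.
    by rewrite onth_set_nth // h1 -lt.
  split=> //; exists 2, [::]; rewrite cats0; split=> //.
  by apply: mifP; rewrite hs; apply: mskipP.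
- split; first by case: ws.
  exists 1, [:: drop (spos s) (sword s)]; split=> //; first by rewrite /= -cats1.
  by apply: mcallP => i _ /=; rewrite !onthE map_drop nth_drop.
- have /andP[p1 p2] := pr.
  have [w1 [t1 [l1 [le1 e1 H1]]]] := IH1 s p1 ws.
  have [w2 [t2 [l2 [le2 e2 H2]]]] := IH2 _ p2 w1.
  split=> //; exists (t1 + t2), (l1 ++ l2); split; first by rewrite /=; lia.
    by rewrite /= e2 e1 catA.
  exact: mseqP H1 H2.
- have /andP[p1 p2] := pr.
  have [w1 [t1 [l1 [le1 e1 H1]]]] := IH1 s p1 ws.
  have [w2 [t2 [l2 [le2 e2 H2]]]] := IH2 s p2 ws.
  rewrite /compiles /=; case E : (sflag s f).
    split=> //; exists t1.+1, l1; split=> //; first by lia.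
    by apply: mifP; rewrite /holds /= E.
  split=> //; exists t2.+1, l2; split=> //; first by lia.
  by apply: mifP; rewrite /holds /= E.
- have /andP[nr pc] := pr.
  have [h1 h2 h3] := ws.
  have H1 := rewindP (h3 r).
  pose s0 := set_reg r 0 s.
  pose f s := inc_reg N r (den O N c s).
  have I i : i <= N -> wf (iter i f s0) /\ sreg (iter i f s0) r = i.
    elim: i => [|i IHi] le; first by split; [exact: wf_set|rewrite /= upd_eq].
    have [w e] := IHi (ltnW le); split; rewrite iterS.
      by apply: wf_inc; case: (IH _ pc w).
    by rewrite /f /= upd_eq (modifiesP O pc (wf_bounded w)).2 // e; apply/minn_idPr.
  have [||t2 [l2 [le2 e2 H2]]] := @mwhile_st (on_cell (Some r) isSome)
    (mseq (module_of c) (mmove (Some r) MoveRight)) f (cost c L).+1 N s0.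
  + move=> i lt s'; have [w e] := I i (ltnW lt); split.
      by rewrite /holds /on_cell /areads /aread /= e rcontS lt.
    have [w' [t [l [le el H]]]] := IH _ pc w.
    exists (t + 1), (l ++ [::]); rewrite cats0; split=> //; first by lia.
    rewrite -[l]cats0; apply: mseqP H _; apply: move_reg.
    by rewrite (modifiesP O pc (wf_bounded w)).2 // e; apply/minn_idPr.
  + by have [_ e] := I N (leqnn N); rewrite /holds /on_cell /areads /aread /= e rcontS ltnn.
  have [w e] := I N (leqnn N).
  have := @rewindP r (iter N f s0); rewrite e => /(_ (leqnn N)) H3.
  split; first exact: wf_set.
  exists (sreg s r * 2 + 1 + (t2 + (N * 2 + 1))), ([::] ++ (l2 ++ [::])); split.
  + have : N * (cost c L).+2 <= L * (cost c L).+2 by rewrite leq_mul2r N_le orbT.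
    by have := h3 r; rewrite /= addn2; lia.
  + by rewrite cats0 /= e2.
  + exact: mseqP H1 (mseqP H2 H3).
- have /and4P[nrz nr nz pc] := pr.
  have [h1 h2 h3] := ws.
  have H1 := rewindP (h3 z).
  have w0 : wf (set_reg z 0 s) by exact: wf_set.
  have [|w1 [t1 [l1 [le1 e1 H2]]]] := @mdrainP r z (den O N c) (module_of c) (cost c L) _ nrz w0.
    move=> s' w'; have [_ h] := modifiesP O pc (wf_bounded w').
    by have [w'' h'] := IH _ pc w'; rewrite !h.
  have nzr : z != r by rewrite eq_sym.
  have [|w2 [t2 [l2 [le2 e2 H3]]]] := @mdrainP z r id mskip 1 _ nzr w1.
    move=> s' w'; split=> //; exists 1, [::]; rewrite cats0; split=> //.
    exact: mskipP.
  split=> //; exists (sreg s z * 2 + 1 + (t1 + t2)), ([::] ++ (l1 ++ l2)); split.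
  + by have := h3 z; rewrite /=; lia.
  + by rewrite /= e2 e1 catA.
  + exact: mseqP H1 (mseqP H2 H3).
Qed.

End Correctness.

(** ** Reading the input *)

Definition all_tapes (d : move) (w : option bool -> option bool) (rd : tix -> option bool) :
  acts reg := fun i => (if i is Some _ then w (rd i) else rd i, d).

Definition mall d w : module := mact (fun f rd => (f, all_tapes d w rd)).

(** An encoding starts with [N] ones and a zero. The ones are copied to all
    register tapes simultaneously, which makes them registers of value 0 after
    all heads have moved back. *)
Definition mload (c : cmd) : module :=
  mif (on_cell None (pred1 (Some true)))
    (mseq (mall MoveRight (fun=> Some false))
    (mseq (mwhile (on_cell None (pred1 (Some true))) (mall MoveRight (fun=> Some true)))
      (mif (on_cell None (pred1 (Some false)))
        (mseq (mwhile (on_cell None isSome) (mall MoveLeft id))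
        (mseq (mall MoveRight id) (module_of c)))
        mskip)))
    mskip.

Definition leading (x : word) := find negb x.
(** The words that start with at least one 1 and contain a 0. *)
Definition headed (x : word) := (0 < leading x) && (onth x (leading x) == Some false).

Definition init_st x := St [ffun=> false] x 0 (fun=> 0) [::].

Definition tapes_at N x q : tix -> atape :=
  fun i => ATape (if i is Some _ then rcont N else wcont x) q.

Lemma mallP O f tp d w : term O (mall d w) (f, tp)
  (f, fun i => amove d (if i is Some _ then w (aread (tp i)) else aread (tp i)) (tp i)) 1 [::].
Proof.
have := mactP ans O (fun f rd => (f, all_tapes d w rd)) f tp.
by congr (term _ _ _ (_, _) _ _); apply/funext => -[].
Qed.

Lemma onth_leading x i : i < leading x -> onth x i = Some true.
Proof.
move=> lt; have /negbFE := before_find false lt.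
have : i < size x by apply: leq_trans lt (find_size _ _).
by rewrite onthE => le; rewrite (nth_map false) // => ->.
Qed.

Lemma headed_lt x : headed x -> leading x < size x.
Proof. by case/andP => _ /eqP e; rewrite -onthTE e. Qed.

Lemma mloadP O c x : proper_cmd c -> exists t m' l,
  [/\ t <= cost c (size x) + 4 * size x + 10,
    terminates ans O (mload c) (input_mem reg flag x) m' t l &
    if headed x then m'.1 = sflag (den O (leading x) c (init_st x)) /\
                     l = slog (den O (leading x) c (init_st x))
    else m'.1 ans = false /\ l = [::]].
Proof.
move=> pc; set N := leading x; set f0 : flags := [ffun => false].
case: (posnP N) => [N0|N_gt0].
  have h : headed x = false by rewrite /headed -/N N0.
  exists 2, (input_mem reg flag x), [::]; rewrite h; split; [by lia| |by rewrite /= ffunE].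
  apply: mifP; rewrite (_ : holds _ _ = false); first exact: mskipP.
  rewrite /holds /on_cell /areads /aread /=.
  by move: N0; rewrite /N /leading; case: (x) => [|[] y].
have N_le : N <= size x by apply: find_size.
have H1 : term O (mall MoveRight (fun=> Some false)) (input_mem reg flag x)
    (f0, tapes_at 1 x 2) 1 [::].
  have := mallP O f0 (input_mem reg flag x).2 MoveRight (fun=> Some false).
  congr (term _ _ _ (_, _) _ _); apply/funext => -[r|]; rewrite /amove /= /tapes_at; congr ATape.
    by apply/funext => j; rewrite /upd /rcont; case: eqP => //; case: j => [|[]].
  by rewrite (upd_id (wcont x) 1).
have H2 : term O (mwhile (on_cell None (pred1 (Some true))) (mall MoveRight (fun=> Some true)))
    (f0, tapes_at 1 x 2) (f0, tapes_at N x N.+1) (N.-1 * 2 + 1) [::].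
  have := @mwhile_iter reg flag ans O (on_cell None (pred1 (Some true)))
     (mall MoveRight (fun=> Some true)) (fun i => (f0, tapes_at i.+1 x i.+2)) 1 N.-1.
  rewrite prednK //; apply=> [i lt|]; last first.
    rewrite /holds /on_cell /areads /aread /=; apply/eqP => e.
    have lt : N < size x by rewrite -onthTE e.
    have : has negb x by rewrite has_find.
    by move/(nth_find false); rewrite -/(leading x) -/N (@onth_nth _ false _ _ _ e).
  have e : onth x i.+1 = Some true by apply: onth_leading; rewrite -/N; lia.
  split; first exact/eqP.
  have := mallP O f0 (tapes_at i.+1 x i.+2) MoveRight (fun=> Some true).
  congr (term _ _ _ (_, _) _ _); apply/funext => -[r|]; rewrite /amove /= /tapes_at; congr ATape.
    apply/funext => j; rewrite /upd /rcont; case: eqP => [->|n].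
      by rewrite /= ltnS leqnn.
    by case: eqP => // _; do 2!case: ifP => //; lia.
  by rewrite (upd_id (wcont x) i.+2).
case E : (onth x N == Some false); last first.
  have h : headed x = false by rewrite /headed E andbF.
  exists (1 + ((N.-1 * 2 + 1) + 2)).+1, (f0, tapes_at N x N.+1), [::]; rewrite h.
  split; [by lia| |by rewrite /= ffunE].
  apply: mifP; rewrite (_ : holds _ _ = true).
    apply: mseqP H1 (mseqP H2 _ : term _ _ _ _ _ [::]).
    by apply: mifP; rewrite /holds /on_cell /areads /aread /= E; exact: mskipP.
  by apply: (introT eqP); apply: onth_leading.
have h : headed x by rewrite /headed N_gt0.
rewrite h.
have H3 : term O (mwhile (on_cell None isSome) (mall MoveLeft id))
    (f0, tapes_at N x N.+1) (f0, tapes_at N x 0) (N.+1 * 2 + 1) [::].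
  have := @mwhile_iter reg flag ans O (on_cell None isSome)
     (mall MoveLeft id) (fun i => (f0, tapes_at N x (N.+1 - i))) 1 N.+1.
  rewrite subn0 subnn; apply=> // i lt; split.
    rewrite /holds /on_cell /areads /aread /= subSn // /= onthTE.
    by apply: leq_ltn_trans (headed_lt h); rewrite leq_subr.
  have := mallP O f0 (tapes_at N x (N.+1 - i)) MoveLeft id.
  congr (term _ _ _ (_, _) _ _); apply/funext => j.
  rewrite /tapes_at (_ : N.+1 - i = (N.+1 - i.+1).+1); last by lia.
  by rewrite -[RHS](amove_same MoveLeft _ (N.+1 - i.+1).+1); case: j.
have H4 : term O (mall MoveRight id) (f0, tapes_at N x 0) (mem_of N (init_st x)) 1 [::].
  have := mallP O f0 (tapes_at N x 0) MoveRight id.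
  congr (term _ _ _ (_, _) _ _); apply/funext => -[r|].
    exact: (amove_same MoveRight (rcont N) 0).
  exact: (amove_same MoveRight (wcont x) 0).
have [_ [t [l [le el H]]]] := @module_ofP O N (size x) N_gt0 N_le c (init_st x) pc
  ltac:(by split).
exists (1 + ((N.-1 * 2 + 1) + ((N.+1 * 2 + 1) + (1 + t)).+1)).+1.
exists (mem_of N (den O N c (init_st x))), l; split=> //; first by lia.
apply: mifP; rewrite (_ : holds _ _ = true).
  apply: mseqP H1 (mseqP H2 _ : term _ _ _ _ _ l).
  apply: mifP; rewrite /holds /on_cell /areads /aread /= E.
  exact: mseqP H3 (mseqP H4 H : term _ _ _ _ _ l).
by apply: (introT eqP); apply: onth_leading.
Qed.

End Programs.

(** * Polynomial time *)

Definition polybounded (T : nat -> nat) :=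
  exists p : {poly nat}, forall n, T n <= p.[n]%R.

Lemma polybounded_le T T' : (forall n, T n <= T' n) -> polybounded T' -> polybounded T.
Proof. by move=> le [p hp]; exists p => n; apply: leq_trans (le n) (hp n). Qed.

Lemma polybounded_cst k : polybounded (fun=> k).
Proof. by exists (k%:P)%R => n; rewrite hornerC. Qed.

Lemma polybounded_id : polybounded id.
Proof. by exists 'X%R => n; rewrite hornerX. Qed.

Lemma polybounded_add T T' :
  polybounded T -> polybounded T' -> polybounded (fun n => T n + T' n).
Proof. by move=> [p hp] [q hq]; exists (p + q)%R => n; rewrite hornerD leq_add. Qed.

Lemma polybounded_mul T T' :
  polybounded T -> polybounded T' -> polybounded (fun n => T n * T' n).
Proof. by move=> [p hp] [q hq]; exists (p * q)%R => n; rewrite hornerM leq_mul. Qed.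

Ltac polyb := repeat first
  [ assumption | exact: polybounded_id | exact: polybounded_cst
  | apply: polybounded_add | apply: polybounded_mul ].

Section PolyCmd.
Variables (reg flag : finType) (ans : flag).

Lemma cost_polybounded (c : cmd reg flag) : polybounded (cost c).
Proof.
elim: c => [g||||b||c1 IH1 c2 IH2|f c1 IH1 c2 IH2|r c IH|r z c IH];
  try exact: polybounded_cst.
- by apply: (@polybounded_le _ (fun n => 2 * n + 6)) => //; polyb.
- exact: polybounded_add.
- by apply: (@polybounded_le _ (fun n => 1 + (cost c1 n + cost c2 n))) => //; polyb.
- by apply: (@polybounded_le _ (fun n => n * (cost c n + 2) + 4 * n + 3)) => //; polyb.
- by apply: (@polybounded_le _ (fun n => n * (cost c n + 4) + 7 * n + 3)) => //; polyb.
Qed.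

Definition run_of O (c : cmd reg flag) (x : word) := den ans O (leading x) c (init_st reg flag x).

(** Only denotations have to be considered from here on: resource bounds and
    machines are dealt with for all programs at once. *)
Theorem oracle_machineP (c : cmd reg flag) : proper_cmd c ->
  let M := machine_of ans (mload c) in
  polytime_oracle_machine M /\ forall O x,
    (oaccepts M O x <-> headed x /\ sflag (run_of O c x) ans) /\
    (forall w, queries M O x w <-> headed x /\ w \in slog (run_of O c x)).
Proof.
move=> pc M; split=> [|O x].
  have [p hp] : polybounded (fun n => 3 * (cost c n + 4 * n + 10) + 1).
    by have h := cost_polybounded c; polyb.
  exists p => O x; have [t [m' [l [le H _]]]] := mloadP ans O x pc.
  by have [h _ _] := machine_ofP H; apply: h; apply: leq_trans (hp _); lia.
have [t [m' [l [le H R]]]] := mloadP ans O x pc.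
have [_ h1 h2] := machine_ofP H; split=> [|w].
  by rewrite h1; case: (headed x) R => -[-> _] //; split=> // -[].
by rewrite h2; case: (headed x) R => -[_ ->] //; split=> // -[].
Qed.

End PolyCmd.

(** * Evaluating loop programs *)

Section Den.
Variables (reg flag : finType) (ans : flag) (O : set word) (N : nat).
Local Notation den := (@den reg flag ans O N).
Local Notation cmd := (cmd reg flag).
Local Notation st := (st reg flag).
Implicit Types (c : cmd) (s : st) (r : reg).

Definition cskip : cmd := CFlag _ (fun f _ => f).
Definition nest (rs : seq reg) c : cmd := foldr (@CFor reg flag) c rs.
Definition seqs (cs : seq cmd) : cmd := foldr (@CSeq reg flag) cskip cs.

Lemma den_skip s : den cskip s = s.
Proof. by case: s. Qed.

Lemma den_seqs_cons c cs s : den (seqs (c :: cs)) s = den (seqs cs) (den c s).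
Proof. by []. Qed.

Lemma set_regC r q u v s : r != q ->
  set_reg r u (set_reg q v s) = set_reg q v (set_reg r u s).
Proof. by move=> n; rewrite /set_reg /= updC // eq_sym. Qed.

Lemma sreg_set r u s : sreg (set_reg r u s) r = u.
Proof. exact: upd_eq. Qed.

Lemma sreg_set_neq r q u s : q != r -> sreg (set_reg r u s) q = sreg s q.
Proof. exact: upd_neq. Qed.

(** Commuting with all assignments to [r] says that [c] neither reads nor
    changes [r]. *)
Definition ignores r c := forall v s, den c (set_reg r v s) = set_reg r v (den c s).

Lemma ignores_same r c s : ignores r c -> sreg (den c s) r = sreg s r.
Proof. by move=> H; rewrite -{1}(set_reg_id r s) H sreg_set. Qed.

Lemma ignores_right r : ignores r (CRight _ _).
Proof. by move=> v s; rewrite /= /scell /=; case: onth. Qed.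

Lemma ignores_for r q c : q != r -> ignores r c -> ignores r (CFor q c).
Proof.
move=> nqr H v s /=; rewrite (set_regC _ _ _ nqr).
have -> k : iter k (fun s => inc_reg N q (den c s)) (set_reg r v (set_reg q 0 s)) =
   set_reg r v (iter k (fun s => inc_reg N q (den c s)) (set_reg q 0 s)).
  by elim: k => //= k ->; rewrite H /inc_reg sreg_set_neq // set_regC // eq_sym.
by rewrite set_regC.
Qed.

Lemma ignores_nest r rs c : r \notin rs -> ignores r c -> ignores r (nest rs c).
Proof.
move=> nr H; elim: rs nr => //= q rs IH; rewrite inE negb_or eq_sym => /andP[n1 n2].
exact: ignores_for n1 (IH n2).
Qed.

Lemma den_nest rs c s : uniq rs -> (forall r, r \in rs -> sreg s r = 0) ->
  (forall r, r \in rs -> ignores r c) ->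
  den (nest rs c) s = iter (N ^ size rs) (den c) s.
Proof.
elim: rs s => [|r rs IH] s; first by rewrite expn0.
move=> /= /andP[nr ur] z0 ig.
have igr : ignores r (nest rs c).
  by apply: ignores_nest nr _; apply: ig; rewrite inE eqxx.
have step k : iter k (fun s => inc_reg N r (den (nest rs c) s)) (set_reg r 0 s) =
    set_reg r (minn N k) (iter (k * N ^ size rs) (den c) s).
  elim: k => [|k IHk]; first by rewrite minn0.
  rewrite iterS IHk igr /inc_reg sreg_set set_reg2 mulSn iterD.
  rewrite (_ : minn N (minn N k).+1 = minn N k.+1); last by lia.
  rewrite IH // => [q qr|q qr]; last by apply: ig; rewrite inE qr orbT.
  have : forall m, sreg (iter m (den c) s) q = 0.
    elim=> /= [|m IHm]; first by apply: z0; rewrite inE qr orbT.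
    by rewrite ignores_same //; apply: ig; rewrite inE qr orbT.
  by [].
rewrite [nest _ _]/= step set_reg2 expnS.
have <- : sreg (iter (N * N ^ size rs) (den c) s) r = 0.
  elim: (N * _) => /= [|m IHm]; first by apply: z0; rewrite inE eqxx.
  by rewrite ignores_same //; apply: ig; rewrite inE eqxx.
by rewrite set_reg_id.
Qed.

(** The head cannot leave the word by more than one cell. *)
Lemma iter_right k s : spos s <= size (sword s) ->
  iter k (den (CRight _ _)) s = set_pos (minn (size (sword s)) (spos s + k)) s.
Proof.
move=> le; elim: k => [|k IH].
  by rewrite addn0 (minn_idPr le) /=; case: (s).
rewrite iterS IH /= /scell /=; case E : (onth _ _) => [b|].
  have := onthTE (sword s) (minn (size (sword s)) (spos s + k)); rewrite E => /esym /= lt.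
  rewrite /set_pos /=; congr St; lia.
have := onthTE (sword s) (minn (size (sword s)) (spos s + k)); rewrite E => /esym /= lt.
rewrite /set_pos /=; congr St; lia.
Qed.

Lemma iter_left k s : iter k (den (CLeft _ _)) s = set_pos (spos s - k) s.
Proof.
elim: k => [|k IH]; first by rewrite subn0; case: s.
by rewrite iterS IH /= /set_pos /= subnS.
Qed.

Lemma den_drain v z f s : v != z ->
  (forall u s, f (set_reg v u s) = set_reg v u (f s)) ->
  (forall u s, f (set_reg z u s) = set_reg z u (f s)) ->
  sreg s v + sreg s z <= N ->
  drain N v z f s =
  set_reg z (sreg s v + sreg s z) (set_reg v 0 (iter (sreg s v) f s)).
Proof.
move=> nvz igv igz le.
have step k : k <= sreg s v ->
    iter k (fun s => f (inc_reg N z (dec_reg v s))) s =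
    set_reg z (k + sreg s z) (set_reg v (sreg s v - k) (iter k f s)).
  elim: k => [|k IH] lek; first by rewrite subn0 !set_reg_id.
  rewrite iterS (IH (ltnW lek)) /dec_reg sreg_set_neq // sreg_set.
  rewrite (set_regC _ _ _ nvz) set_reg2 /inc_reg sreg_set set_reg2 igz igv.
  congr (set_reg _ _ (set_reg _ _ _)); last by lia.
  by rewrite addSn; apply/minn_idPr; lia.
by rewrite /drain step // subnn.
Qed.

Lemma den_upto v z c s : v != z -> ignores v c -> ignores z c ->
  sreg s v <= N -> sreg s z = 0 ->
  den (CUpto v z c) s = iter (sreg s v) (den c) s.
Proof.
move=> nvz igv igz lev z0.
have nzv : z != v by rewrite eq_sym.
rewrite [LHS]/= -{1}z0 set_reg_id.
set s' := iter (sreg s v) (den c) s.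
have [ev ez] : sreg s' v = sreg s v /\ sreg s' z = 0.
  have E k : sreg (iter k (den c) s) v = sreg s v /\ sreg (iter k (den c) s) z = 0.
    by elim: k => //= k [IH1 IH2]; rewrite !ignores_same.
  exact: E.
have skip n (s0 : st) : iter n id s0 = s0 by elim: n.
rewrite (den_drain nvz) // ?z0 ?addn0 // -/s' (den_drain nzv) //.
- rewrite skip sreg_set sreg_set_neq 1?eq_sym // sreg_set addn0.
  by rewrite set_reg2 (set_regC _ _ _ nzv) set_reg2 -[X in set_reg z X]ez set_reg_id -ev set_reg_id.
- by rewrite sreg_set sreg_set_neq 1?eq_sym // sreg_set addn0.
Qed.

End Den.

(** * Positions in the encoding of a structure *)

Section Blocks.
Variables (T : eqType) (f : T -> nat).
Implicit Types (rs : seq T).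

(** The start of the block of [r] when blocks of lengths [f q], for [q] in
    [rs], are concatenated. *)
Definition offset rs r := sumn [seq f q | q <- take (index r rs) rs].

Lemma offset_cons q rs r :
  offset (q :: rs) r = if q == r then 0 else f q + offset rs r.
Proof. by rewrite /offset /=; case: eqP. Qed.

Lemma offset_lt rs r m : r \in rs -> m < f r -> offset rs r + m < sumn [seq f q | q <- rs].
Proof.
elim: rs => //= q rs IH; rewrite inE offset_cons eq_sym; case: eqP => [<- _|_ /= rrs] lt.
  by rewrite add0n ltn_addr.
by rewrite -addnA ltn_add2l IH.
Qed.

Lemma offset_onto rs j : uniq rs -> j < sumn [seq f q | q <- rs] ->
  exists r m, [/\ r \in rs, m < f r & j = offset rs r + m].
Proof.
elim: rs j => //= q rs IH j /andP[nq u] lt; case: (ltnP j (f q)) => le.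
  by exists q, j; rewrite inE eqxx offset_cons eqxx.
have [//||r [m [rrs mlt e]]] := IH (j - f q); first by lia.
exists r, m; rewrite inE rrs orbT offset_cons; split=> //.
case: eqP nq => [->|_ _]; first by rewrite rrs.
by lia.
Qed.

Lemma offset_inj rs r m r' m' : r \in rs -> r' \in rs -> m < f r -> m' < f r' ->
  offset rs r + m = offset rs r' + m' -> r = r' /\ m = m'.
Proof.
elim: rs => //= q rs IH; rewrite !inE !offset_cons ![_ == q]eq_sym.
case: eqP => [<- _|_ /= h]; case: eqP => [<- _|_ /= h'] lt lt' e.
- by split=> //; lia.
- by lia.
- by lia.
- by apply: IH => //; lia.
Qed.

Lemma onth_blocks (U : Type) (g : T -> nat -> U) rs r m : r \in rs -> m < f r ->
  onth (flatten [seq [seq g q i | i <- iota 0 (f q)] | q <- rs]) (offset rs r + m) =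
  Some (g r m).
Proof.
elim: rs => //= q rs IH; rewrite inE offset_cons eq_sym onth_cat size_map size_iota.
case: eqP => [<- _|_ /= rrs] lt.
  by rewrite lt onth_map onthE (nth_map 0) ?size_iota // nth_iota.
by rewrite ltnNge -addnA leq_addr /= addKn IH.
Qed.

Lemma size_blocks (U : Type) (g : T -> nat -> U) rs :
  size (flatten [seq [seq g q i | i <- iota 0 (f q)] | q <- rs]) = sumn [seq f q | q <- rs].
Proof. by elim: rs => //= q rs IH; rewrite size_cat size_map size_iota IH. Qed.
End Blocks.

Fixpoint digits_val (N : nat) (ws : seq nat) : nat :=
  if ws is w :: ws' then w * N ^ size ws' + digits_val N ws' else 0.

Lemma digits_val_lt N ws : all (fun w => w < N) ws -> digits_val N ws < N ^ size ws.
Proof.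
elim: ws => [|w ws IH] /=; first by rewrite expn0.
move=> /andP[lt h]; rewrite expnS; apply: (@leq_trans (w * N ^ size ws + N ^ size ws)).
  by rewrite ltn_add2l IH.
by rewrite -mulSnr leq_mul2r lt orbT.
Qed.

Lemma digits_val_digit N ws i : all (fun w => w < N) ws -> i < size ws ->
  (digits_val N ws %/ N ^ (size ws - i.+1)) %% N = nth 0 ws i.
Proof.
elim: ws i => //= w ws IH [|i] /andP[lt h] li.
  have N_gt0 : 0 < N by lia.
  rewrite subSS subn0 divnMDl ?expn_gt0 ?N_gt0 // divn_small ?digits_val_lt // addn0.
  by rewrite modn_small.
have N_gt0 : 0 < N by lia.
have -> : w * N ^ size ws = (w * N ^ i * N) * N ^ (size ws - i.+1).
  by rewrite -!mulnA -expnS -expnD; congr (_ * _ ^ _); lia.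
by rewrite subSS divnMDl ?expn_gt0 ?N_gt0 // modnMDl IH.
Qed.

Section Encoding.
Variable tau : signature.
Variable n : nat.
Local Notation N := n.+1.
Implicit Types (I : forall R : tau, (ar R).-tuple 'I_N -> Prop).

Definition tuple_rank k (t : k.-tuple 'I_N) := digits_val N [seq val a | a <- t].

Lemma tuple_rank_lt k (t : k.-tuple 'I_N) : tuple_rank t < N ^ k.
Proof.
rewrite -[X in _ < _ ^ X](size_tuple t) -(size_map val); apply: digits_val_lt.
by apply/allP => _ /mapP[a _ ->] /=.
Qed.

Lemma lex_tuple_rank k (t : k.-tuple 'I_N) : lex_tuple n k (tuple_rank t) = t.
Proof.
apply/eq_from_tnth => i; rewrite tnth_mktuple; apply/val_inj.
have e : (tuple_rank t %/ N ^ (k - i.+1)) %% N = tnth t i.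
  rewrite -[X in X - _](size_tuple t) -(size_map val) digits_val_digit.
  - by rewrite (nth_map ord0) ?size_tuple // -tnth_nth.
  - by apply/allP => _ /mapP[a _ ->] /=.
  - by rewrite size_map size_tuple.
by rewrite /= inordK e.
Qed.

(** Ranking is injective by [lex_tuple_rank], and there are as many tuples as
    ranks. *)
Lemma tuple_rank_onto k m : m < N ^ k -> exists t : k.-tuple 'I_N, tuple_rank t = m.
Proof.
move=> lt; pose r (t : k.-tuple 'I_N) := Ordinal (tuple_rank_lt t).
have inj : injective r by move=> t u [e]; rewrite -(lex_tuple_rank t) e lex_tuple_rank.
have /codomP[t e] : Ordinal lt \in codom r.
  by apply: inj_card_onto; rewrite ?card_tuple ?card_ord.
by exists t; case: e.
Qed.

Definition arity_pow (R : tau) := N ^ ar R.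
Definition code_size := N.+1 + sumn [seq arity_pow R | R <- enum tau].

Lemma size_encode I : size (encode I) = code_size.
Proof.
by rewrite /encode size_cat size_nseq /= (size_blocks arity_pow) /code_size addnS addSn.
Qed.

Lemma onth_encode_prefix I i : i < N -> onth (encode I) i = Some true.
Proof. by move=> lt; rewrite /encode onth_cat size_nseq lt onth_nseq lt. Qed.

Lemma onth_encode_sep I : onth (encode I) N = Some false.
Proof. by rewrite /encode onth_cat size_nseq ltnn subnn. Qed.

Definition bit_at (R : tau) (t : (ar R).-tuple 'I_N) :=
  N.+1 + (offset arity_pow (enum tau) R + tuple_rank t).

Lemma onth_encode I R t : onth (encode I) (@bit_at R t) = Some `[< I R t >].
Proof.
rewrite /encode /bit_at onth_cat size_nseq ltnNge addSnnS leq_addr /= addKn /=.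
rewrite (onth_blocks (f := arity_pow) (fun R m => `[< I R (lex_tuple n (ar R) m) >])) ?mem_enum //.
  by rewrite lex_tuple_rank.
exact: tuple_rank_lt.
Qed.

Lemma bit_at_lt R t : @bit_at R t < code_size.
Proof. by rewrite /bit_at /code_size ltn_add2l offset_lt ?mem_enum //; exact: tuple_rank_lt. Qed.

Lemma bit_at_onto j : N < j -> j < code_size -> exists R t, j = @bit_at R t.
Proof.
move=> lt1 lt2; have [||R [m [_ lt e]]] := @offset_onto _ arity_pow (enum tau) (j - N.+1).
- exact: enum_uniq.
- by rewrite -(ltn_add2r N.+1) subnK // addnC.
have [t et] := tuple_rank_onto lt.
by exists R, t; rewrite /bit_at et; lia.
Qed.

Lemma bit_at_inj R t R' t' : @bit_at R t = @bit_at R' t' ->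
  existT (fun R => (ar R).-tuple 'I_N) R t = existT _ R' t'.
Proof.
move=> /addnI /(offset_inj (f := arity_pow)).
rewrite !mem_enum => /(_ isT isT (tuple_rank_lt _) (tuple_rank_lt _))[eR].
case: _ / eR t' => t' e; congr existT.
by rewrite -(lex_tuple_rank t) e lex_tuple_rank.
Qed.

Lemma encode_inj I I' : encode I = encode I' -> I = I'.
Proof.
move=> e; apply: functional_extensionality_dep => R; apply/funext => t; apply/propext.
have := onth_encode I t; rewrite e onth_encode => -[h].
by split=> /asboolP; [rewrite -h|rewrite h] => /asboolP.
Qed.

Definition add_tuple I R (t : (ar R).-tuple 'I_N) : forall R, (ar R).-tuple 'I_N -> Prop :=
  fun R' t' => I R' t' \/ existT (fun R => (ar R).-tuple 'I_N) R' t' = existT _ R t.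

(** This is why the words obtained by flipping a 0 are the right queries. *)
Lemma encode_add_tuple I R t :
  encode (@add_tuple I R t) = set_nth false (encode I) (bit_at t) true.
Proof.
have lt := bit_at_lt t; rewrite -(size_encode I) in lt.
apply: eq_from_onth => j; rewrite onth_set_nth // /upd.
case: (ltnP j code_size) => [lj|gj]; last first.
  rewrite !onth_default ?size_encode //; case: eqP => // e.
  by move: lt; rewrite -e size_encode ltnNge gj.
case: (ltngtP j N) => [lN|gN|->].
- by rewrite !onth_encode_prefix //; case: eqP.
- have [R' [t' ->]] := bit_at_onto gN lj.
  rewrite !onth_encode; case: eqP => [/bit_at_inj e|ne].
    by congr Some; apply/asboolP; right.
  congr Some; apply: asbool_equiv_eq; split=> [[//|e]|]; last by left.
  by case: ne; exact: (congr1 (fun u => @bit_at (projT1 u) (projT2 u)) e).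
- by rewrite !onth_encode_sep; case: eqP => // e; move: (leq_addr (offset arity_pow (enum tau) R + tuple_rank t) N.+1); rewrite -/(bit_at t) -e ltnn.
Qed.

Lemma encode_onto x : headed x -> leading x = N -> size x = code_size ->
  exists I, encode I = x.
Proof.
move=> /andP[_ /eqP hs] eN sz; rewrite eN in hs.
exists (fun R t => onth x (@bit_at R t) = Some true).
apply: eq_from_onth => j; case: (ltnP j code_size) => [lj|gj]; last first.
  by rewrite !onth_default ?size_encode ?sz.
case: (ltngtP j N) => [lN|gN|->].
- by rewrite !onth_encode_prefix // onth_leading // eN.
- have [R [t e]] := bit_at_onto gN lj.
  have := onthTE x j; rewrite sz lj e onth_encode.
  by case: onth => // -[] _; congr Some; apply/asboolP.
- by rewrite onth_encode_sep hs.
Qed.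

Lemma leading_encode I : leading (encode I) = N.
Proof. by rewrite /leading /encode find_cat has_nseq andbF size_nseq /= addn0. Qed.

Lemma headed_encode I : headed (encode I).
Proof. by rewrite /headed leading_encode onth_encode_sep eqxx. Qed.
End Encoding.

(** * The self-reduction as a loop program *)

Section Program.
Variables (tau : signature) (D : nat).
Hypothesis ar_le : forall R : tau, ar R <= D.

(** Registers for variables on the left, and registers for nested counting
    loops on the right; the last one of these is the auxiliary register of
    [CUpto]. *)
Definition preg : finType := ('I_D.+1 + 'I_D.+1)%type.
Definition pflag : finType := option 'I_D.+1.
Definition ans : pflag := None.
Definition vreg (d : nat) : preg := inl (inord d).
Definition scr (j : nat) : preg := inr (inord j).
Definition spare : preg := inr ord_max.
Definition fl (d : nat) : pflag := Some (inord d).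

Local Notation cmd := (cmd preg pflag).
Local Notation st := (st preg pflag).
Local Notation CRight := (CRight preg pflag).
Local Notation CLeft := (CLeft preg pflag).
Local Notation CHome := (CHome preg pflag).
Local Notation CAsk := (CAsk preg pflag).
Local Notation CWrite := (CWrite preg pflag).
Local Notation cskip := (cskip preg pflag).

Definition scratch k := [seq scr j | j <- iota 0 k].
Definition adv k : cmd := nest (scratch k) CRight.

Fixpoint digits (vs : seq nat) : cmd :=
  if vs is v :: vs' then CSeq (CUpto (vreg v) spare (adv (size vs'))) (digits vs') else cskip.

Definition goto (R : tau) (vs : seq nat) : cmd :=
  seqs (CHome :: CFor spare CRight :: CRight ::
    rcons [seq adv (ar R') | R' <- take (index R (enum tau)) (enum tau)] (digits vs)).

Definition assign (g : flags pflag -> option bool -> bool) (d : nat) : cmd :=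
  CFlag _ (fun f c => updf f (fl d) (g f c)).

Definition combine (op : bool -> bool -> bool) (d : nat) : cmd :=
  CFlag _ (fun f _ => updf (updf f (fl d) (op (f (fl d)) (f (fl d.+1)))) (fl d.+1) false).

(** The head moves to position N - b + a. The header of an encoding has its zero
    at position N, so a 1 is read if a < b, and a 0 if a = b. If a > b then
    anything may be read, but a 1 is read once a and b are exchanged. Hence
    a = b if and only if a 0 is read both times. *)
Definition eq_half (a b d : nat) : cmd :=
  seqs [:: CHome; CFor spare CRight; CUpto (vreg b) spare CLeft; CUpto (vreg a) spare CRight;
    assign (fun _ c => c == Some false) d; CHome].

(** [d] is the index of the flag that receives the truth value and of the
    register of the next quantifier, and [ce] gives the registers of the
    variables. A quantifier always takes a new register, so that a nested
    quantifier over the same variable does not overwrite it. *)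
Fixpoint eval_fo (d : nat) (ce : nat -> nat) (phi : fo tau) : cmd :=
  match phi with
  | FFalse => cskip
  | FEq x y => seqs [:: eq_half (ce x) (ce y) d; eq_half (ce y) (ce x) d.+1; combine andb d]
  | FRel R v => seqs [:: goto R [seq ce x | x <- v]; assign (fun _ c => c == Some true) d; CHome]
  | FNot p => CSeq (eval_fo d ce p) (assign (fun f _ => ~~ f (fl d)) d)
  | FAnd p q => seqs [:: eval_fo d ce p; eval_fo d.+1 ce q; combine andb d]
  | FOr p q => seqs [:: eval_fo d ce p; eval_fo d.+1 ce q; combine orb d]
  | FImp p q => seqs [:: eval_fo d ce p; eval_fo d.+1 ce q; combine implb d]
  | FAll x p => CSeq (assign (fun _ _ => true) d)
      (CFor (vreg d) (CSeq (eval_fo d.+1 (update ce x d) p) (combine andb d)))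
  | FEx x p => CSeq (assign (fun _ _ => false) d)
      (CFor (vreg d) (CSeq (eval_fo d.+1 (update ce x d) p) (combine orb d)))
  end.

Fixpoint depth (phi : fo tau) : nat :=
  match phi with
  | FFalse | FRel _ _ => 0
  | FEq _ _ => 1
  | FNot p => depth p
  | FAnd p q | FOr p q | FImp p q => maxn (depth p) (depth q).+1
  | FAll _ p | FEx _ p => (depth p).+1
  end.

(** The query is read from the start of the word. The head returns to the
    flipped bit by computing its position again. *)
Definition ask_flipped (R : tau) : cmd :=
  let vs := iota 0 (ar R) in
  seqs [:: goto R vs; assign (fun _ c => c == Some false) 0;
    CIf (fl 0) (seqs [:: CWrite true; CHome; CAsk; goto R vs; CWrite false;
                         assign (fun _ _ => false) 0]) cskip;
    CHome].

Definition ask_all (S : pred tau) : cmd :=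
  seqs [seq nest [seq vreg j | j <- iota 0 (ar R)] (ask_flipped R) | R <- enum tau & S R].

Definition check_bit : cmd := CSeq (assign (fun f c => f (fl 0) || (c == None)) 0) CRight.

(** The head walks over the header and all blocks, while flag 0 records any
    attempt to walk on behind the word. The length is right if there was none
    and the walk ends at the first cell behind the word. *)
Definition validate : cmd :=
  seqs (CHome :: CFor spare CRight :: CRight ::
    [seq nest (scratch (ar R)) check_bit | R <- enum tau] ++
    [:: assign (fun f c => ~~ f (fl 0) && (c == None)) 0; CHome]).

(** Evaluation starts at level 1: register 0 keeps the value 0 and serves for
    variables that are not bound. *)
Definition self_reduction (phi : fo tau) (S : pred tau) : cmd :=
  CSeq validate (CIf (fl 0)
    (seqs [:: assign (fun _ _ => false) 0; eval_fo 1 (fun=> 0) phi;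
       CIf (fl 1) (CFlag _ (fun f _ => updf f ans true)) (ask_all S)])
    cskip).

Section Semantics.
Variables (O : set word) (n : nat).
Local Notation N := n.+1.
Local Notation den := (@den preg pflag ans O N).
Implicit Types (s : st) (d k v : nat).

Definition scratch_zero s := forall j, sreg s (inr j) = 0.
Definition set_fl d b s := set_flags (updf (sflag s) (fl d) b) s.

Lemma inord_neq i j : i <= D -> j <= D -> i != j -> (inord i : 'I_D.+1) != inord j.
Proof. by move=> li lj; rewrite -val_eqE /= !inordK. Qed.

Lemma uniq_scratch k : k <= D -> uniq (scratch k).
Proof.
move=> le; rewrite map_inj_in_uniq ?iota_uniq // => i j; rewrite !mem_iota !add0n => /= hi hj [].
move/eqP; apply: contraTeq; apply: inord_neq; lia.
Qed.

Lemma spare_scratch k : k <= D -> spare \notin scratch k.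
Proof.
move=> le; apply/negP => /mapP[j]; rewrite mem_iota add0n => /= lt [] /(congr1 val) /=.
by rewrite inordK; lia.
Qed.

Lemma vreg_scratch d k : vreg d \notin scratch k.
Proof. by apply/negP => /mapP[]. Qed.

Lemma vreg_neq i j : i <= D -> j <= D -> i != j -> vreg i != vreg j.
Proof.
by move=> li lj nij; apply/negP => /eqP[] /eqP; apply/negP/inord_neq.
Qed.

Lemma fl_neq i j : i <= D -> j <= D -> i != j -> fl i != fl j.
Proof.
by move=> li lj nij; apply/negP => /eqP[] /eqP; apply/negP/inord_neq.
Qed.

Lemma set_pos2 p q s : set_pos p (set_pos q s) = set_pos p s.
Proof. by []. Qed.

Lemma set_pos_id s : set_pos (spos s) s = s.
Proof. by case: s. Qed.

Local Notation sz s := (size (sword s)).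

Lemma den_adv k s : k <= D -> scratch_zero s -> spos s <= sz s ->
  den (adv k) s = set_pos (minn (sz s) (spos s + N ^ k)) s.
Proof.
move=> le cs lp; rewrite den_nest ?uniq_scratch //.
- by rewrite iter_right // size_map size_iota.
- by move=> r /mapP[j _ ->]; exact: cs.
- by move=> r _; apply: ignores_right.
Qed.

Lemma den_upto_adv v k s : k <= D -> scratch_zero s -> spos s <= sz s -> sreg s (vreg v) <= N ->
  den (CUpto (vreg v) spare (adv k)) s =
  set_pos (minn (sz s) (spos s + sreg s (vreg v) * N ^ k)) s.
Proof.
move=> le cs lp lv; rewrite den_upto //.
- elim: (sreg s _) => [|m IH].
    by rewrite mul0n addn0 (minn_idPr lp) set_pos_id.
  by rewrite iterS IH den_adv //= ?geq_minl // set_pos2; congr set_pos; lia.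
- by apply: ignores_nest (vreg_scratch _ _) _; apply: ignores_right.
- by apply: ignores_nest (spare_scratch le) _; apply: ignores_right.
- exact: cs.
Qed.

Lemma den_digits vs s : size vs <= D.+1 -> scratch_zero s -> spos s <= sz s ->
  (forall v, v \in vs -> sreg s (vreg v) <= N) ->
  den (digits vs) s =
  set_pos (minn (sz s) (spos s + digits_val N [seq sreg s (vreg v) | v <- vs])) s.
Proof.
elim: vs s => [|v vs IH] s le cs lp lv.
  by rewrite addn0 (minn_idPr lp) set_pos_id; case: (s).
rewrite -[LHS]/(den (digits vs) (den (CUpto (vreg v) spare (adv (size vs))) s)).
rewrite den_upto_adv //; last by apply: lv; rewrite inE eqxx.
rewrite IH //=; [|exact: ltnW|exact: geq_minl|by move=> u hu; apply: lv; rewrite inE hu orbT].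
by rewrite set_pos2 size_map; congr set_pos; lia.
Qed.

Lemma den_skip_block rs s c : scratch_zero s -> spos s <= sz s ->
  den (seqs (rcons [seq adv (ar R) | R : tau <- rs] c)) s =
  den (CSeq c cskip) (set_pos (minn (sz s) (spos s + sumn [seq N ^ ar R | R <- rs])) s).
Proof.
elim: rs s => [|R rs IH] s cs lp.
  by rewrite addn0 (minn_idPr lp) set_pos_id.
rewrite map_cons rcons_cons den_seqs_cons den_adv // IH //= ?geq_minl // set_pos2.
by rewrite (_ : minn _ _ = minn (sz s) (spos s + (N ^ ar R + sumn [seq N ^ ar R | R <- rs]))) //; lia.
Qed.

Lemma den_skip_size s : scratch_zero s -> spos s <= sz s ->
  den (CFor spare CRight) s = set_pos (minn (sz s) (spos s + N)) s.
Proof.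
move=> cs lp; rewrite -[CFor _ _]/(nest [:: spare] CRight) den_nest //.
- by rewrite iter_right // expn1.
- by move=> r; rewrite inE => /eqP ->; exact: cs.
- by move=> r _; apply: ignores_right.
Qed.

Lemma den_right s : spos s <= sz s -> den CRight s = set_pos (minn (sz s) (spos s).+1) s.
Proof. by move=> lp; rewrite -[den _ _]/(iter 1 (den CRight) s) iter_right // addn1. Qed.

Lemma den_skip_header cs s : scratch_zero s ->
  den (seqs (CHome :: CFor spare CRight :: CRight :: cs)) s =
  den (seqs cs) (set_pos (minn (sz s) N.+1) s).
Proof.
move=> h; rewrite !den_seqs_cons.
have -> : den CHome s = set_pos 0 s by [].
rewrite den_skip_size // den_right /= ?geq_minl // set_pos2.
by rewrite (_ : minn _ (minn _ _).+1 = minn (sz s) N.+1) //; lia.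
Qed.

Lemma den_goto R vs s : size vs = ar R -> scratch_zero s ->
  (forall v, v \in vs -> sreg s (vreg v) <= N) ->
  den (goto R vs) s = set_pos (minn (sz s)
   (N.+1 + (offset (arity_pow n) (enum tau) R + digits_val N [seq sreg s (vreg v) | v <- vs]))) s.
Proof.
move=> sv cs lv; rewrite den_skip_header // den_skip_block //= ?geq_minl //.
rewrite den_digits //= ?geq_minl // ?sv ?leqW // set_pos2.
by rewrite -/(offset _ _ _) /set_flags /set_pos /=; congr St; rewrite /offset /arity_pow; lia.
Qed.

Lemma den_upto_left v s : scratch_zero s -> sreg s (vreg v) <= N ->
  den (CUpto (vreg v) spare CLeft) s = set_pos (spos s - sreg s (vreg v)) s.
Proof. by move=> cs lv; rewrite den_upto // ?iter_left //; exact: cs. Qed.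

Lemma den_upto_right v s : scratch_zero s -> sreg s (vreg v) <= N -> spos s <= sz s ->
  den (CUpto (vreg v) spare CRight) s = set_pos (minn (sz s) (spos s + sreg s (vreg v))) s.
Proof.
move=> cs lv lp; rewrite den_upto //; try exact: ignores_right; last exact: cs.
exact: iter_right.
Qed.

(** ** Evaluation of formulas *)

Lemma flagsP (f g : flags pflag) : f =1 g -> f = g.
Proof. by move=> h; apply/ffunP. Qed.

Lemma set_fl_twice d b b' s : set_fl d b (set_fl d b' s) = set_fl d b s.
Proof. by rewrite /set_fl /set_flags /=; congr St; apply: flagsP => x; rewrite !ffunE /upd ffunE /upd; case: eqP. Qed.

Lemma set_fl_id d s : set_fl d (sflag s (fl d)) s = s.
Proof.
case: s => f w p g l; rewrite /set_fl /set_flags /=; congr St.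
by apply: flagsP => x; rewrite ffunE upd_id.
Qed.

Lemma sflag_set_fl d b s : sflag (set_fl d b s) (fl d) = b.
Proof. by rewrite ffunE upd_eq. Qed.

Lemma sflag_set_fl_neq d b s x : x != fl d -> sflag (set_fl d b s) x = sflag s x.
Proof. by move=> nx; rewrite ffunE upd_neq. Qed.

Lemma den_if f c1 c2 s : den (CIf f c1 c2) s = if sflag s f then den c1 s else den c2 s.
Proof. by []. Qed.

Lemma den_write b s : den (CWrite b) s =
  if scell s is Some _ then set_word (set_nth false (sword s) (spos s) b) s else s.
Proof. by []. Qed.

Lemma den_seq c1 c2 s : den (CSeq c1 c2) s = den c2 (den c1 s).
Proof. by []. Qed.

Lemma den_seqs_nil s : den (seqs [::]) s = s.
Proof. exact: den_skip. Qed.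

Lemma den_assign g d s : den (assign g d) s = set_fl d (g (sflag s) (scell s)) s.
Proof. by []. Qed.

(** The flag of level [d.+1] is cleared again, so that it can be reused. *)
Lemma den_combine op d b b' s : d.+1 <= D -> sflag s (fl d.+1) = false ->
  den (combine op d) (set_fl d.+1 b' (set_fl d b s)) = set_fl d (op b b') s.
Proof.
move=> lt h.
have n1 : fl d != fl d.+1 by apply: fl_neq => //; lia.
have n2 : fl d.+1 != fl d by rewrite eq_sym.
rewrite /= /set_fl /set_flags /=; congr St; apply: flagsP => x.
rewrite !(ffunE, eqxx, negPf n1) /upd !(ffunE, eqxx, negPf n1) /upd !(ffunE, eqxx, negPf n1) /upd.
case: (x =P fl d.+1) => [->|_]; first by rewrite (negPf n2) h.
by case: (x =P fl d) => // nx; rewrite ffunE /upd; case: eqP.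
Qed.

Section Formulas.
Variable I : forall R : tau, (ar R).-tuple 'I_N -> Prop.
Local Notation L := (code_size tau n).

(** At level [d], the flags and registers from index [d] on are free for use and
    have to be cleared. *)
Record fit d s : Prop := Fit {
  fit_word : sword s = encode I;
  fit_pos : spos s = 0;
  fit_scratch : scratch_zero s;
  fit_lt : forall j, sreg s (vreg j) < N;
  fit_reg : forall j, d <= j <= D -> sreg s (vreg j) = 0;
  fit_flag : forall j, d <= j <= D -> sflag s (fl j) = false
}.

Lemma fit_size d s : fit d s -> sz s = L.
Proof. by move/fit_word ->; rewrite size_encode. Qed.

Lemma fit_flags d s b : d.+1 <= D -> fit d s -> fit d.+1 (set_fl d b s).
Proof.
move=> lt [h1 h2 h3 h4 h5 h6]; split=> // j jd; first by apply: h5; lia.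
by rewrite sflag_set_fl_neq ?h6 ?fl_neq //; lia.
Qed.

Definition env (ce : nat -> nat) s : nat -> 'I_N := fun x => inord (sreg s (vreg (ce x))).

Lemma den_eq_half a b d s : fit d s ->
  den (eq_half a b d) s =
  set_fl d (onth (encode I) (minn L (N - sreg s (vreg b) + sreg s (vreg a))) == Some false) s.
Proof.
move=> hf; have hL : N < L by rewrite /code_size; lia.
have lb := ltnW (fit_lt hf b); have la := ltnW (fit_lt hf a).
have cs := fit_scratch hf; have es := fit_size hf.
rewrite /eq_half !den_seqs_cons.
have -> : den CHome s = s by rewrite /= -(fit_pos hf) set_pos_id.
rewrite den_skip_size // ?(fit_pos hf) // es add0n (minn_idPr (ltnW hL)).
rewrite den_upto_left // set_pos2.
rewrite den_upto_right // ?set_pos2 /= ?es; last by lia.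
rewrite -(fit_word hf) /set_fl /set_pos /scell /set_flags /=.
by case: (s) (fit_pos hf) => f w p g l /= ->.
Qed.

Lemma eq_cell a b : a < N -> b < N ->
  (onth (encode I) (minn L (N - b + a)) == Some false) &&
  (onth (encode I) (minn L (N - a + b)) == Some false) = (a == b).
Proof.
move=> la lb; have hL : N < L by rewrite /code_size; lia.
have half u v : u < v -> v < N -> (onth (encode I) (minn L (N - v + u)) == Some false) = false.
  move=> uv vN; rewrite (minn_idPr _); last by lia.
  by rewrite onth_encode_prefix //; lia.
case: (ltngtP a b) => [ab|ba|->].
- by rewrite half.
- by rewrite [X in _ && X]half // andbF.
- by rewrite subnK ?(ltnW lb) // (minn_idPr (ltnW hL)) onth_encode_sep eqxx.
Qed.

Lemma den_quant op b0 d c s (v : nat -> bool) : d.+1 <= D -> fit d s ->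
  (forall k b, k < N -> den c (set_reg (vreg d) k (set_fl d b s)) =
     set_reg (vreg d) k (set_fl d (op b (v k)) s)) ->
  den (CSeq (assign (fun _ _ => b0) d) (CFor (vreg d) c)) s =
  set_fl d (foldl (fun b k => op b (v k)) b0 (iota 0 N)) s.
Proof.
move=> ld hf H.
have r0 : sreg s (vreg d) = 0 by apply: (fit_reg hf); lia.
rewrite -[LHS]/(set_reg (vreg d) 0 (iter N (fun s => inc_reg N (vreg d) (den c s))
   (set_reg (vreg d) 0 (set_fl d b0 s)))).
have step k : k <= N -> iter k (fun s => inc_reg N (vreg d) (den c s))
   (set_reg (vreg d) 0 (set_fl d b0 s)) =
   set_reg (vreg d) k (set_fl d (foldl (fun b k => op b (v k)) b0 (iota 0 k)) s).
  elim: k => [//|k IH] lk; rewrite iterS (IH (ltnW lk)) H // /inc_reg sreg_set set_reg2.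
  by rewrite (minn_idPr lk) -[in iota 0 k.+1]addn1 iotaD foldl_cat.
rewrite step // set_reg2; set b := foldl _ _ _.
by rewrite -[X in set_reg _ X](_ : sreg (set_fl d b s) (vreg d) = 0) // set_reg_id.
Qed.

Lemma foldl_all (v : nat -> bool) (ks : seq nat) b :
  foldl (fun b k => b && v k) b ks = b && all v ks.
Proof. by elim: ks b => [|k ks IH] b /=; rewrite ?andbT // IH andbA. Qed.

Lemma foldl_has (v : nat -> bool) (ks : seq nat) b :
  foldl (fun b k => b || v k) b ks = b || has v ks.
Proof. by elim: ks b => [|k ks IH] b /=; rewrite ?orbF // IH orbA. Qed.

Lemma env_update ce s d x k b : (forall x, ce x < d) -> d <= D ->
  env (update ce x d) (set_reg (vreg d) k (set_fl d b s)) = update (env ce s) x (inord k).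
Proof.
move=> lc ld; apply/funext => y; rewrite /env /update; case: eqP => _.
  by rewrite sreg_set.
by rewrite sreg_set_neq // vreg_neq //; have := lc y; lia.
Qed.

Local Notation sat e phi := (@sat tau (structure_on I) e phi).

Lemma den_quant_body op d ce x p k b s : depth p + d.+1 <= D ->
  (forall ce s, (forall x, ce x < d.+1) -> fit d.+1 s ->
     den (eval_fo d.+1 ce p) s = set_fl d.+1 `[< sat (env ce s) p >] s) ->
  (forall x, ce x < d) -> fit d s -> k < N ->
  den (CSeq (eval_fo d.+1 (update ce x d) p) (combine op d)) (set_reg (vreg d) k (set_fl d b s)) =
  set_reg (vreg d) k (set_fl d (op b `[< sat (update (env ce s) x (inord k)) p >]) s).
Proof.
move=> ld IH lc hf lk.
have hd : d.+1 <= D by lia.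
have hs : sflag s (fl d.+1) = false by apply: (fit_flag hf); lia.
set s' := set_reg _ _ _.
have hf' : fit d.+1 s'.
  have [h1 h2 h3 h4 h5 h6] := fit_flags b hd hf; split=> //.
  + by move=> j; rewrite /s' /= /upd; case: eqP => // _; exact: h4.
  + by move=> j jd; rewrite sreg_set_neq ?h5 // vreg_neq //; lia.
rewrite -[LHS]/(den (combine op d) (den (eval_fo d.+1 (update ce x d) p) s')) IH //; last first.
  by move=> y; rewrite /update; case: eqP => // _; exact: ltnW (lc y).
rewrite /s' env_update //; last by lia.
exact: (@den_combine op d b _ (set_reg (vreg d) k s)).
Qed.

Lemma den_eval_fo phi d ce s : depth phi + d <= D -> (forall x, ce x < d) -> fit d s ->
  den (eval_fo d ce phi) s = set_fl d `[< sat (env ce s) phi >] s.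
Proof.
elim: phi d ce s => [|x y|R v|p IH|p IHp q IHq|p IHp q IHq|p IHp q IHq|x p IH|x p IH] d ce s ld lc hf.
- rewrite den_skip -{1}(set_fl_id d s) (fit_flag hf); last by rewrite /= in ld; lia.
  by rewrite (_ : `[< _ >] = false) //; apply/asboolP.
- have hd : d.+1 <= D by rewrite /= in ld; lia.
  have hs : sflag s (fl d.+1) = false by apply: (fit_flag hf); lia.
  rewrite -[eval_fo _ _ _]/(seqs [:: eq_half (ce x) (ce y) d; eq_half (ce y) (ce x) d.+1; combine andb d]) 3!den_seqs_cons (den_eq_half _ _ hf) (den_eq_half _ _ (fit_flags _ hd hf)).
  rewrite den_combine // den_skip [X in set_fl d X]eq_cell; try exact: (fit_lt hf).
  congr set_fl; apply/eqP/asboolP => [e|]; first by rewrite /= /env e.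
  by move/(congr1 (@nat_of_ord N)); rewrite /env !inordK ?(fit_lt hf).
- rewrite -[eval_fo _ _ _]/(seqs [:: goto R [seq ce x | x <- v]; assign (fun _ c => c == Some true) d; CHome]) 3!den_seqs_cons den_skip.
  have lv u : u \in [seq ce x | x <- v] -> sreg s (vreg u) <= N.
    by move=> _; exact: ltnW (fit_lt hf u).
  rewrite (den_goto _ (fit_scratch hf) lv) ?size_map ?size_tuple //.
  set t := map_tuple (env ce s) v.
  have -> : [seq sreg s (vreg i) | i <- [seq ce x | x <- v]] = [seq val a | a <- t].
    rewrite -!map_comp; by apply: eq_map => x /=; rewrite inordK // (fit_lt hf).
  rewrite -[_ + (_ + _)]/(bit_at t) (fit_size hf) (minn_idPr (ltnW (bit_at_lt t))).
  have E : scell (set_pos (bit_at t) s) = Some `[< I t >].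
    by rewrite -onth_encode -(fit_word hf).
  rewrite den_assign E.
  have -> : (Some `[< I t >] == Some true) = `[< I t >] by case: asbool.
  by rewrite -[X in _ = set_fl _ _ X]set_pos_id (fit_pos hf).
- rewrite -[LHS]/(den (assign (fun f _ => ~~ f (fl d)) d) (den (eval_fo d ce p) s)).
  by rewrite IH // den_assign sflag_set_fl set_fl_twice -asbool_neg.
- have [l1 l2 hd] : [/\ depth p + d <= D, depth q + d.+1 <= D & d.+1 <= D] by move: ld => /= ld; split; lia.
  have hs : sflag s (fl d.+1) = false by apply: (fit_flag hf); lia.
  rewrite -[eval_fo _ _ _]/(seqs [:: eval_fo d ce p; eval_fo d.+1 ce q; combine andb d]) 3!den_seqs_cons den_skip IHp // IHq //; last exact: fit_flags.
    by rewrite den_combine // -asbool_and.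
  by move=> x; exact: ltnW (lc x).
- have [l1 l2 hd] : [/\ depth p + d <= D, depth q + d.+1 <= D & d.+1 <= D] by move: ld => /= ld; split; lia.
  have hs : sflag s (fl d.+1) = false by apply: (fit_flag hf); lia.
  rewrite -[eval_fo _ _ _]/(seqs [:: eval_fo d ce p; eval_fo d.+1 ce q; combine orb d]) 3!den_seqs_cons den_skip IHp // IHq //; last exact: fit_flags.
    by rewrite den_combine // -asbool_or.
  by move=> x; exact: ltnW (lc x).
- have [l1 l2 hd] : [/\ depth p + d <= D, depth q + d.+1 <= D & d.+1 <= D] by move: ld => /= ld; split; lia.
  have hs : sflag s (fl d.+1) = false by apply: (fit_flag hf); lia.
  rewrite -[eval_fo _ _ _]/(seqs [:: eval_fo d ce p; eval_fo d.+1 ce q; combine implb d]) 3!den_seqs_cons den_skip IHp // IHq //; last exact: fit_flags.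
    by rewrite den_combine // -asbool_imply.
  by move=> x; exact: ltnW (lc x).
- rewrite /= addSnnS in ld.
  rewrite (@den_quant andb true d _ s (fun k => `[< sat (update (env ce s) x (inord k)) p >])).
  + congr set_fl; rewrite foldl_all; apply/allP/asboolP => [H a|H k _].
      have := H a; rewrite mem_iota ltn_ord inord_val => /(_ isT)/asboolP; exact.
    exact/asboolP/H.
  + by lia.
  + by [].
  + by move=> k b lk; apply: den_quant_body => // *; exact: IH.
- rewrite /= addSnnS in ld.
  rewrite (@den_quant orb false d _ s (fun k => `[< sat (update (env ce s) x (inord k)) p >])).
  + congr set_fl; rewrite foldl_has; apply/hasP/asboolP => [[k _ /asboolP H]|[a H]].
      by exists (inord k).
    by exists (val a); [rewrite mem_iota ltn_ord|rewrite inord_val; apply/asboolP].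
  + by lia.
  + by [].
  + by move=> k b lk; apply: den_quant_body => // *; exact: IH.
Qed.

(** ** Oracle queries *)

(** The answers are accumulated in a single flag, so a program that only asks is
    determined by the sequence of its queries. *)
Definition after_queries (l : seq word) s : st :=
  St (updf (sflag s) ans (sflag s ans || has (fun w => `[< O w >]) l))
     (sword s) (spos s) (sreg s) (slog s ++ l).

Lemma after_queries_nil s : after_queries [::] s = s.
Proof.
case: s => f w p g l; rewrite /after_queries /= orbF cats0; congr St.
by apply: flagsP => x; rewrite ffunE upd_id.
Qed.

Lemma after_queries_cat l1 l2 s : after_queries (l1 ++ l2) s = after_queries l2 (after_queries l1 s).
Proof.
rewrite /after_queries /= catA ffunE upd_eq has_cat orbA; congr St.
by apply: flagsP => x; rewrite !ffunE /upd ffunE /upd; case: eqP.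
Qed.

Record idle s : Prop := Idle {
  idle_word : sword s = encode I;
  idle_pos : spos s = 0;
  idle_scratch : scratch_zero s;
  idle_lt : forall j, sreg s (vreg j) < N;
  idle_flag : sflag s (fl 0) = false
}.

Lemma idle_after_queries l s : idle s -> idle (after_queries l s).
Proof. by case=> h1 h2 h3 h4 h5; split=> //; rewrite /= ffunE upd_neq. Qed.

Lemma idle_set_reg d k s : k < N -> idle s -> idle (set_reg (vreg d) k s).
Proof.
move=> lk [h1 h2 h3 h4 h5]; by split=> // j; rewrite /= /upd; case: eqP.
Qed.

Definition tuple_at (R : tau) (g : preg -> nat) : (ar R).-tuple 'I_N :=
  [tuple inord (g (vreg i)) | i < ar R].

Definition flip_query (R : tau) (g : preg -> nat) : seq word :=
  if `[< I (tuple_at R g) >] then [::] else [:: encode (add_tuple I (tuple_at R g))].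

Lemma tuple_at_val R s : idle s ->
  [seq sreg s (vreg j) | j <- iota 0 (ar R)] = [seq val a | a <- tuple_at R (sreg s)].
Proof.
move=> hs; rewrite -val_enum_ord -!map_comp; apply: eq_map => i /=.
by rewrite inordK // (idle_lt hs).
Qed.

Lemma den_ask_flipped R s : idle s ->
  den (ask_flipped R) s = after_queries (flip_query R (sreg s)) s.
Proof.
move=> hs; have hc := idle_scratch hs; have hw := idle_word hs.
have lv v : v \in iota 0 (ar R) -> sreg s (vreg v) <= N by move=> _; exact: ltnW (idle_lt hs v).
have hg (J : forall R : tau, (ar R).-tuple 'I_N -> Prop) s' :
    sword s' = encode J -> sreg s' = sreg s ->
    den (goto R (iota 0 (ar R))) s' = set_pos (bit_at (tuple_at R (sreg s))) s'.
  move=> ew er; rewrite den_goto ?size_iota ?er //; last by move=> j; rewrite er.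
  rewrite tuple_at_val // -[_ + (_ + _)]/(bit_at (tuple_at R (sreg s))).
  by rewrite ew size_encode (minn_idPr (ltnW (bit_at_lt _))).
set t := tuple_at R (sreg s) in hg *; set p := bit_at t in hg *.
rewrite den_seqs_cons (hg I) // den_seqs_cons den_assign.
have -> : scell (set_pos p s) = Some `[< I t >] by rewrite -onth_encode -hw.
rewrite /flip_query -/t 2!den_seqs_cons den_seqs_nil den_if sflag_set_fl.
have back s' f l : s' = St f (encode I) p (sreg s) l -> den CHome s' =
    St f (encode I) 0 (sreg s) l by move->.
case E : `[< I t >].
  rewrite after_queries_nil den_skip (back _ (sflag s) (slog s)).
    by case: (s) hw (idle_pos hs) => f w q g l /= -> ->.
  rewrite -hw -[in RHS](set_fl_id 0 s) (idle_flag hs).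
  by [].
set s1 := set_fl 0 _ _; pose I' := add_tuple I t.
rewrite 6!den_seqs_cons.
have -> : den (CWrite true) s1 = set_word (encode I') s1.
  rewrite den_write (_ : scell s1 = Some false).
    by rewrite /I' encode_add_tuple -hw.
  by rewrite -E -onth_encode -hw.
pose s2 := ask_oracle ans O (encode I') (set_pos 0 (set_word (encode I') s1)).
have -> : den CAsk (den CHome (set_word (encode I') s1)) = s2.
  by rewrite /s2 -{2}(drop0 (encode I')).
rewrite (hg I') //.
(* The bit that was flipped is 0 again. *)
have restore : set_nth false (encode I') p false = encode I.
  apply: eq_from_onth => j; rewrite encode_add_tuple.
  have lp : p < size (encode I) by rewrite size_encode bit_at_lt.
  rewrite onth_set_nth ?size_set_nth ?(maxn_idPr lp) // onth_set_nth // upd_upd /upd.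
  by case: eqP => // ->; rewrite onth_encode E.
have -> : den (CWrite false) (set_pos p s2) = set_word (encode I) (set_pos p s2).
  rewrite den_write (_ : scell _ = Some true) -?restore //.
  by rewrite -[LHS]/(onth (encode I') p) onth_encode; congr Some; apply/asboolP; right.
rewrite den_assign den_seqs_nil (back _ (sflag (set_fl 0 false s2)) (slog s2)) //.
rewrite /after_queries -hw /= -cats1 (idle_pos hs) orbF; congr St.
apply: flagsP => x; rewrite !ffunE /upd ffunE /upd !ffunE /upd.
by case: (x =P fl 0) => [->|_] //; case: eqP => //; rewrite ?(idle_flag hs).
Qed.

Fixpoint assign_regs (g : preg -> nat) (vs ws : seq nat) : preg -> nat :=
  match vs, ws with
  | v :: vs', w :: ws' => assign_regs (upd g (vreg v) w) vs' ws'
  | _, _ => g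
  end.

Lemma den_nest_queries (Q : (preg -> nat) -> seq word) c vs s :
  (forall s, idle s -> den c s = after_queries (Q (sreg s)) s) ->
  uniq [seq vreg v | v <- vs] -> idle s -> (forall v, v \in vs -> sreg s (vreg v) = 0) ->
  exists l, den (nest [seq vreg v | v <- vs] c) s = after_queries l s /\
    forall q, q \in l <-> exists ws,
      [/\ size ws = size vs, all (fun w => w < N) ws & q \in Q (assign_regs (sreg s) vs ws)].
Proof.
move=> hc; elim: vs s => [|v vs IH] s /=.
  move=> _ hs _; exists (Q (sreg s)); split; first exact: hc.
  move=> q; split=> [h|[[|w ws] [//]]] //; by exists [::].
move=> /andP[nv u] hs z0.
pose F s := inc_reg N (vreg v) (den (nest [seq vreg v | v <- vs] c) s).
have step k : k <= N -> exists l, iter k F (set_reg (vreg v) 0 s) = set_reg (vreg v) k (after_queries l s) /\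
    forall q, q \in l <-> exists w ws, [/\ w < k, size ws = size vs, all (fun w => w < N) ws &
      q \in Q (assign_regs (upd (sreg s) (vreg v) w) vs ws)].
  elim: k => [|k IHk] lk.
    by exists [::]; rewrite after_queries_nil; split=> // q; split=> // -[w [ws []]].
  have [l [el hl]] := IHk (ltnW lk).
  have [//|||l' [el' hl']] := IH (set_reg (vreg v) k (after_queries l s)).
  + exact/idle_set_reg/idle_after_queries.
  + move=> w hw; rewrite sreg_set_neq; first by apply: z0; rewrite inE hw orbT.
    by apply: contra nv => /eqP <-; apply: map_f.
  exists (l ++ l'); split.
    rewrite iterS el /F el' /inc_reg [sreg _ _]/= upd_eq (minn_idPr lk).
    by rewrite after_queries_cat /set_reg /after_queries /= upd_upd.
  move=> q; rewrite mem_cat; split=> [/orP[/hl[w [ws [h1 h2 h3 h4]]]|/hl'[ws [h2 h3 h4]]]|].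
  + by exists w, ws; split=> //; exact: ltnW.
  + by exists k, ws.
  + case=> w [ws [h1 h2 h3 h4]]; apply/orP; case: (eqVneq w k) => [e|ne].
      by right; apply/hl'; exists ws; rewrite -e.
    by left; apply/hl; exists w, ws; split=> //; lia.
have [l [el hl]] := step N (leqnn N); exists l; split.
  rewrite -[LHS]/(set_reg (vreg v) 0 (iter N F (set_reg (vreg v) 0 s))) el set_reg2 -[X in set_reg _ X](_ : sreg (after_queries l s) (vreg v) = 0) ?set_reg_id //=.
  by apply: z0; rewrite inE eqxx.
move=> q; rewrite hl; split=> [[w [ws [h1 h2 h3 h4]]]|[[|w ws] [//= [h2] /andP[h1 h3] h4]]].
  by exists (w :: ws); rewrite /= h2 h1 h3.
by exists w, ws.
Qed.

Lemma assign_regs_out g vs ws r : r \notin [seq vreg v | v <- vs] -> assign_regs g vs ws r = g r.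
Proof.
elim: vs ws g => [|v vs IH] [|w ws] g //=; rewrite inE negb_or => /andP[n1 n2].
by rewrite IH // upd_neq.
Qed.

Lemma assign_regs_nth g vs ws i : uniq [seq vreg v | v <- vs] -> size ws = size vs ->
  i < size vs -> assign_regs g vs ws (vreg (nth 0 vs i)) = nth 0 ws i.
Proof.
elim: vs ws g i => [|v vs IH] [|w ws] g [|i] //= /andP[nv u] [sz] lt.
  by rewrite assign_regs_out // upd_eq.
exact: IH.
Qed.

Lemma uniq_vregs k : k <= D.+1 -> uniq [seq vreg v | v <- iota 0 k].
Proof.
move=> le; rewrite map_inj_in_uniq ?iota_uniq // => i j; rewrite !mem_iota !add0n => /= hi hj /eqP.
by apply: contraTeq; apply: vreg_neq; lia.
Qed.

Lemma tuple_at_assign R g ws : size ws = ar R ->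
  tuple_at R (assign_regs g (iota 0 (ar R)) ws) = [tuple inord (nth 0 ws i) | i < ar R].
Proof.
move=> sw; apply: eq_from_tnth => i; rewrite !tnth_mktuple; congr inord.
rewrite -[X in vreg X](nth_iota 0 0 (ltn_ord i)) assign_regs_nth ?size_iota //.
by apply: uniq_vregs; exact: leqW.
Qed.

Lemma den_ask_relation R s : idle s -> (forall j, sreg s (vreg j) = 0) ->
  exists l, den (nest [seq vreg v | v <- iota 0 (ar R)] (ask_flipped R)) s = after_queries l s /\
    forall q, q \in l <-> exists t, ~ I t /\ q = encode (@add_tuple tau n I R t).
Proof.
move=> hs z0; have u : uniq [seq vreg v | v <- iota 0 (ar R)] by apply/uniq_vregs/leqW.
have [l [el hl]] := den_nest_queries (@den_ask_flipped R) u hs (fun v _ => z0 v).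
exists l; split=> // q; rewrite hl; split=> [[ws []]|[t [nt ->]]].
  rewrite size_iota => sw _; rewrite /flip_query; case: asboolP => // nI.
  by rewrite inE => /eqP ->; exists (tuple_at R (assign_regs (sreg s) (iota 0 (ar R)) ws)).
exists [seq val a | a <- t]; split; first by rewrite size_map size_tuple size_iota.
  by apply/allP => _ /mapP[a _ ->] /=.
have -> : flip_query R (assign_regs (sreg s) (iota 0 (ar R)) [seq val a | a <- t]) =
    [:: encode (add_tuple I t)]; last by rewrite inE eqxx.
have e : tuple_at R (assign_regs (sreg s) (iota 0 (ar R)) [seq val a | a <- t]) = t.
  rewrite tuple_at_assign ?size_map ?size_tuple //; apply: eq_from_tnth => i.
  by rewrite tnth_mktuple (nth_map ord0) ?size_tuple // -tnth_nth inord_val.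
by rewrite /flip_query e; case: asboolP.
Qed.

Lemma den_ask_all (S : pred tau) s : idle s -> (forall j, sreg s (vreg j) = 0) ->
  exists l, den (ask_all S) s = after_queries l s /\
    forall q, q \in l <-> exists R t, [/\ S R, ~ I t & q = encode (@add_tuple tau n I R t)].
Proof.
move=> hs z0; rewrite /ask_all.
suff H (rs : seq tau) s' : idle s' -> (forall j, sreg s' (vreg j) = 0) ->
  exists l, den (seqs [seq nest [seq vreg v | v <- iota 0 (ar R)] (ask_flipped R) | R <- rs]) s' =
    after_queries l s' /\
  forall q, q \in l <-> exists R t, [/\ R \in rs, ~ I t & q = encode (@add_tuple tau n I R t)].
  have [l [el hl]] := H [seq R <- enum tau | S R] s hs z0.
  exists l; split=> // q; rewrite hl; split=> -[R [t [h1 h2 h3]]]; exists R, t.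
    by move: h1; rewrite mem_filter => /andP[].
  by rewrite mem_filter mem_enum h1.
elim: rs s' => [|R rs IH] s' hs' z0'.
  by exists [::]; rewrite after_queries_nil den_seqs_nil; split=> // q; split=> // -[R [t []]].
have [l [el hl]] := den_ask_relation R hs' z0'.
have [l' [el' hl']] := IH (after_queries l s') (idle_after_queries l hs') z0'.
exists (l ++ l'); rewrite after_queries_cat -el' map_cons den_seqs_cons el; split=> // q.
rewrite mem_cat; split=> [/orP[/hl[t [h1 h2]]|/hl'[R' [t [h1 h2 h3]]]]|].
- by exists R, t; rewrite inE eqxx.
- by exists R', t; rewrite inE h1 orbT.
- case=> R' [t [h1 h2 h3]]; apply/orP; move: h1; rewrite inE => /orP[/eqP e|h1].
    by left; apply/hl; case: _ / e t h2 h3 => t h2 h3; exists t.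
  by right; apply/hl'; exists R', t.
Qed.

End Formulas.

(** ** Validation of the input *)

(** The head stays inside the word or behind its last symbol, and flag 0 tells
    whether [m] lies further. *)
Definition scanned m s := set_pos (minn (sz s) m) (set_fl 0 (sz s < m) s).

Lemma den_check_bit m s : den check_bit (scanned m s) = scanned m.+1 s.
Proof.
rewrite -[LHS]/(den CRight (den (assign (fun f c => f (fl 0) || (c == None)) 0) (scanned m s))).
rewrite den_assign [X in set_fl _ (X || _)]ffunE upd_eq.
have -> : (scell (scanned m s) == None) = (sz s <= m).
  have := onthTE (sword s) (minn (sz s) m); rewrite /scell /=.
  by case: onth => [b|] /= e; [apply/esym/negbTE|rewrite eqxx]; lia.
rewrite den_right ?geq_minl // /scanned -[set_pos _ _]/(set_pos _ (set_fl 0 _ (set_fl 0 _ s))).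
rewrite set_fl_twice; congr (set_pos _ (set_fl _ _ _)); rewrite /=; lia.
Qed.

Lemma den_check_block (R : tau) m s : scratch_zero s ->
  den (nest (scratch (ar R)) check_bit) (scanned m s) = scanned (m + arity_pow n R) s.
Proof.
move=> cs; rewrite den_nest ?uniq_scratch //.
- rewrite size_map size_iota /arity_pow.
  by elim: (_ ^ _) => [|k IH]; rewrite ?addn0 // iterS IH den_check_bit addnS.
- by move=> r /mapP[j _ ->]; exact: cs.
- move=> r _ v s'; pose check := assign (fun f c => f (fl 0) || (c == None)) 0.
  exact: (@ignores_right preg pflag ans O N r v (den check s')).
Qed.

Lemma den_validate s : scratch_zero s -> N < sz s -> sflag s (fl 0) = false ->
  den validate s = set_fl 0 (sz s == code_size tau n) (set_pos 0 s).
Proof.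
move=> cs lt f0; rewrite den_skip_header //.
have -> : set_pos (minn (sz s) N.+1) s = scanned N.+1 s.
  by rewrite /scanned (_ : (sz s < N.+1) = sflag s (fl 0)) ?set_fl_id // f0; lia.
have H rs m cmds : den (seqs ([seq nest (scratch (ar R)) check_bit | R : tau <- rs] ++ cmds)) (scanned m s) =
   den (seqs cmds) (scanned (m + sumn [seq arity_pow n R | R <- rs]) s).
  elim: rs m => [|R rs IH] m; first by rewrite addn0.
  by rewrite map_cons cat_cons den_seqs_cons den_check_block // IH /= addnA.
rewrite H 2!den_seqs_cons den_seqs_nil den_assign -[_ + _]/(code_size tau n).
set m := code_size _ _; rewrite [X in ~~ X]ffunE upd_eq.
have -> : (scell (scanned m s) == None) = (sz s <= m).
  have := onthTE (sword s) (minn (sz s) m); rewrite /scell /=.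
  by case: onth => [b|] /= e; [apply/esym/negbTE|rewrite eqxx]; lia.
have -> : ~~ (sz s < m) && (sz s <= m) = (sz s == m) by lia.
rewrite -[LHS]/(set_pos 0 (set_fl 0 _ (set_fl 0 _ s))) set_fl_twice.
by [].
Qed.

End Semantics.
(** ** Correctness of the program *)

Section Run.
Variables (phi : fo tau) (S : pred tau).
Hypothesis depth_lt : depth phi < D.

Local Notation prog := (self_reduction phi S).
Local Notation run O x := (run_of ans O prog x).

Lemma run_invalid O x : headed x -> size x != code_size tau (leading x).-1 ->
  sflag (run O x) ans = false /\ slog (run O x) = [::].
Proof.
move=> hx nsz; have [lt0 _] := andP hx.
have hlt : (leading x).-1.+1 < size x by rewrite prednK // headed_lt.
 rewrite /run_of -(prednK lt0).
rewrite den_seq den_validate //; last by rewrite ffunE.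
rewrite den_if sflag_set_fl [sword _]/= (negPf nsz) den_skip.
by rewrite /= !ffunE upd_neq // ffunE.
Qed.

Lemma run_encode O n (I : forall R : tau, (ar R).-tuple 'I_n.+1 -> Prop) :
  if `[< @sat tau (structure_on I) (fun=> ord0) phi >]
  then sflag (run O (encode I)) ans /\ slog (run O (encode I)) = [::]
  else sflag (run O (encode I)) ans = has (fun w => `[< O w >]) (slog (run O (encode I))) /\
    forall q, q \in slog (run O (encode I)) <->
      exists R t, [/\ S R, ~ I R t & q = encode (@add_tuple tau n I R t)].
Proof.
pose s0 := init_st preg pflag (encode I).
rewrite /run_of leading_encode.
rewrite den_seq -/s0.
rewrite den_validate //; last by rewrite ffunE.
  2: by rewrite size_encode /code_size addSn ltnS leq_addr.
rewrite den_if sflag_set_fl [sword _]/= size_encode eqxx 3!den_seqs_cons den_seqs_nil.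
rewrite den_assign set_fl_twice.
have -> : set_fl 0 false (set_pos 0 s0) = s0.
  rewrite /set_fl /set_flags /s0 /=; congr St; apply: flagsP => y.
  by rewrite !ffunE /upd !ffunE; case: eqP.
have hf : fit I 1 s0 by split=> // j _; rewrite ffunE.
rewrite (den_eval_fo (ce := fun=> 0) _ _ _ hf) ?addn1 //.
have -> : env n (fun=> 0) s0 = (fun=> ord0) :> (nat -> 'I_n.+1).
  by apply/funext => y; apply/val_inj; rewrite /env /= inordK.
rewrite den_if sflag_set_fl; case E : `[< _ >].
  by rewrite /= ffunE upd_eq.
have hi : idle I (set_fl 1 false s0).
  by split=> //; rewrite sflag_set_fl_neq ?ffunE // fl_neq //; apply: leq_trans depth_lt.
have [l [-> hl]] := den_ask_all O S hi (fun=> erefl).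
by rewrite /= !ffunE upd_eq upd_neq // ffunE; split.
Qed.

Lemma modifies_nest (rs : seq preg) (c : cmd) : modifies (nest rs c) = rs ++ modifies c.
Proof. by elim: rs => //= r rs ->. Qed.

Lemma proper_nest (rs : seq preg) (c : cmd) : uniq rs ->
  (forall r, r \in rs -> r \notin modifies c) -> proper_cmd c -> proper_cmd (nest rs c).
Proof.
elim: rs => //= r rs IH /andP[nr u] h pc; rewrite modifies_nest mem_cat negb_or nr h ?inE ?eqxx //=.
by apply: IH => // q hq; apply: h; rewrite inE hq orbT.
Qed.

Lemma proper_seqs (cs : seq cmd) : proper_cmd (seqs cs) = all (@proper_cmd preg pflag) cs.
Proof. by elim: cs => //= c cs ->. Qed.

(** Code for level [d] only assigns variable registers from index [d] on; hence
    it can be the body of loops over registers of smaller index. *)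
Definition touches d (r : preg) := if r is inl i then d <= i else true.
Definition within d (c : cmd) := all (touches d) (modifies c).

Lemma within_seqs d (cs : seq cmd) : within d (seqs cs) = all (within d) cs.
Proof. by elim: cs => //= c cs <-; rewrite /within /= all_cat. Qed.

Lemma touches_le d d' : d <= d' -> subpred (touches d') (touches d).
Proof. by move=> le [i|j] //=; apply: leq_trans. Qed.

Lemma within_vreg d d' c : d <= D -> d < d' -> within d' c -> vreg d \notin modifies c.
Proof.
rewrite /within => ld lt /allP h; apply/negP => /h /=; rewrite inordK //; lia.
Qed.

Lemma within_adv d k : within d (adv k).
Proof. by rewrite /within modifies_nest cats0; apply/allP => _ /mapP[j _ ->]. Qed.

Lemma within_goto d R vs : within d (goto R vs).
Proof.
have hd : within d (digits vs).
  elim: vs => //= v vs IH; rewrite /within /= all_cat -/(within d _).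
  by apply/andP; split; [exact: within_adv|exact: IH].
rewrite within_seqs /= all_rcons hd /=.
by rewrite all_map; apply/allP => R' _; exact: within_adv.
Qed.

Lemma proper_adv k : k <= D -> proper_cmd (adv k).
Proof. by move=> le; apply: proper_nest => //; exact: uniq_scratch. Qed.

Lemma proper_goto R vs : size vs = ar R -> proper_cmd (goto R vs).
Proof.
move=> sv; have hd us : size us <= D.+1 -> proper_cmd (digits us).
  elim: us => //= v us IH lt; rewrite IH ?(ltnW lt) // andbT proper_adv // andbT.
  by rewrite modifies_nest cats0 vreg_scratch spare_scratch.
rewrite proper_seqs /= all_rcons hd ?sv ?leqW //=.
by rewrite all_map; apply/allP => R' _; exact: proper_adv.
Qed.

Lemma within_eval_fo d ce p : depth p + d <= D -> within d (eval_fo d ce p).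
Proof.
have up d' c : within d'.+1 c -> within d' c by apply: sub_all; exact: touches_le.
elim: p d ce => [|x y|R v|p IH|p IHp q IHq|p IHp q IHq|p IHp q IHq|x p IH|x p IH] d ce ld //.
- by rewrite /within /= all_cat; apply/andP; split; first exact: within_goto.
- by rewrite /within /= cats0; exact: IH.
- by rewrite /within /= !all_cat; apply/and3P; split=> //; [apply: IHp|apply/up/IHq]; move: ld => /=; lia.
- by rewrite /within /= !all_cat; apply/and3P; split=> //; [apply: IHp|apply/up/IHq]; move: ld => /=; lia.
- by rewrite /within /= !all_cat; apply/and3P; split=> //; [apply: IHp|apply/up/IHq]; move: ld => /=; lia.
- rewrite /within /= cats0 inordK ?leqnn; last by move: ld => /=; lia.
  by apply: up; apply: IH; move: ld => /=; lia.
- rewrite /within /= cats0 inordK ?leqnn; last by move: ld => /=; lia.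
  by apply: up; apply: IH; move: ld => /=; lia.
Qed.

Lemma proper_eval_fo d ce p : depth p + d <= D -> proper_cmd (eval_fo d ce p).
Proof.
elim: p d ce => [|x y|R v|p IH|p IHp q IHq|p IHp q IHq|p IHp q IHq|x p IH|x p IH] d ce ld //.
- by apply/andP; split; first by apply: proper_goto; rewrite size_map size_tuple.
- by rewrite /= IH.
- by rewrite /= IHp ?IHq //; move: ld => /=; lia.
- by rewrite /= IHp ?IHq //; move: ld => /=; lia.
- by rewrite /= IHp ?IHq //; move: ld => /=; lia.
- have ld' : depth p + d.+1 <= D by move: ld => /=; lia.
  rewrite /= IH // cats0 !andbT; apply: within_vreg (ltnSn d) (within_eval_fo _ ld').
  by lia.
- have ld' : depth p + d.+1 <= D by move: ld => /=; lia.
  rewrite /= IH // cats0 !andbT; apply: within_vreg (ltnSn d) (within_eval_fo _ ld').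
  by lia.
Qed.

Lemma proper_self_reduction : proper_cmd prog.
Proof.
have pv : proper_cmd validate.
  rewrite proper_seqs /= all_cat all_map andbT; apply/allP => R _.
  by apply: proper_nest => //; exact: uniq_scratch.
have pa : proper_cmd (ask_all S).
  rewrite proper_seqs all_map; apply/allP => R _.
  have hv : within D.+1 (ask_flipped R).
    have := within_goto D.+1 R (iota 0 (ar R)).
    by rewrite /within /ask_flipped; move: (goto _ _) => g hg; rewrite /= !all_cat hg.
  apply: proper_nest.
  - by apply: uniq_vregs; exact: leqW.
  - move=> r /mapP[j]; rewrite mem_iota add0n => /= lt ->.
    by apply: within_vreg hv; have := ar_le R; lia.
  - have : proper_cmd (goto R (iota 0 (ar R))) by apply: proper_goto; rewrite size_iota.
    by rewrite /ask_flipped; move: (goto _ _) => g hg; rewrite /= hg.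
rewrite -[proper_cmd _]/(proper_cmd validate && ((proper_cmd (eval_fo 1 (fun=> 0) phi) &&
  (proper_cmd (ask_all S) && true)) && true)) pv pa !andbT.
by apply: proper_eval_fo; rewrite addn1.
Qed.

End Run.
End Program.

(** * The order *)

Definition covers (x y : word) := (size x == size y) && all2 (fun a b => b ==> a) x y.
(** Compared with a lexicographic order, the pointwise one has short chains. *)
Definition more_ones : rel word := fun x y => covers x y && (x != y).

Lemma covers_cons a x b y : covers (a :: x) (b :: y) = (b ==> a) && covers x y.
Proof. by rewrite /covers /= eqSS; case: (b ==> a); rewrite //= andbF. Qed.

Lemma covers_trans : transitive covers.
Proof.
elim=> [|b y IH] [|a x] [|c z] //; rewrite !covers_cons => /andP[ba xy] /andP[cb yz].
by rewrite (IH _ _ xy yz) andbT; move: ba cb; case: a b c => [] [] [].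
Qed.

Lemma covers_anti x y : covers x y -> covers y x -> x = y.
Proof.
elim: x y => [|a x IH] [|b y] //; rewrite !covers_cons => /andP[ba xy] /andP[ab yx].
by rewrite (IH _ xy yx); move: ba ab; case: a b => [] [].
Qed.

Lemma more_ones_order : strict_partial_order more_ones.
Proof.
split=> [x|y x z /andP[xy nxy] /andP[yz nyz]]; first by rewrite /more_ones eqxx andbF.
rewrite /more_ones (covers_trans xy yz) /=; apply/eqP => e.
by move: nxy; rewrite (covers_anti xy) ?eqxx // e.
Qed.

Lemma covers_count x y : covers x y -> count id y + (x != y) <= count id x.
Proof.
elim: x y => [|a x IH] [|b y] //; rewrite covers_cons => /andP[ba /IH].
by rewrite eqseq_cons /=; case: (x == y); move: ba; case: a b => [] [] //= _; lia.
Qed.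

Lemma more_ones_size x y : more_ones x y -> size x = size y.
Proof. by case/andP => /andP[/eqP]. Qed.

Lemma more_ones_chain x s : path more_ones x s ->
  size s + count id (last x s) <= count id x /\ size (last x s) = size x.
Proof.
elim: s x => [|y s IH] x /=; first by rewrite add0n.
move=> /andP[xy /IH[h ->]]; rewrite (more_ones_size xy); split=> //.
case/andP: xy => /covers_count + nxy; rewrite nxy /=; lia.
Qed.

(** Both words are read in one sweep. A running state [inl b] records whether a
    difference has been seen, and [inr b] is the verdict. *)
Definition order_trans (q : bool + bool) (rd : {ffun 'I_2 -> cell unit}) :
    (bool + bool) * ('I_2 -> cell unit * move) :=
  match q with
  | inl b => match rd ord0, rd ord_max with
     | Some (inl a), Some (inl c) =>
         if c ==> a then (inl (b || (a != c)), fun i => (rd i, MoveRight))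
         else (inr false, fun i => (rd i, Stay))
     | None, None => (inr b, fun i => (rd i, Stay))
     | _, _ => (inr false, fun i => (rd i, Stay))
     end
  | inr b => (inr b, fun i => (rd i, Stay))
  end.

Definition order_machine : machine :=
  @Machine 2 unit (bool + bool)%type (inl false) (inr true) (inr false) order_trans.

Lemma order_machine_run (x y : word) (b : bool) (c : config order_machine) k :
  cstate c = inl b ->
  tright (ctapes c ord0) = [seq Some (inl a) | a <- x] ->
  tright (ctapes c ord_max) = [seq Some (inl a) | a <- y] ->
  size x < k ->
  cstate (iter k (@step order_machine) c) = inr (covers x y && (b || (x != y))).
Proof.
have stop n (r : bool) (c' : config order_machine) : cstate c' = inr r ->
    cstate (iter n (@step order_machine) c') = inr r.
  move=> e; have hc : halted c' by rewrite /halted /accepting e; case: r {e}.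
  by elim: n => //= n; move=> e'; rewrite /step /halted /accepting e'; case: r {e} e'.
elim: x y b c k => [|a x IH] y b c [|k] // es e0 e1 lt; rewrite iterSr.
  have : step c = let: (q, act) := order_trans (inl b) [ffun i => read (ctapes c i)] in
     @Config order_machine q [ffun i => move_head (act i).2 (write (act i).1 (ctapes c i))].
    by rewrite /step /halted /accepting es.
  rewrite /= !ffunE /read e0 e1; case: y {e1} => [|d y] /= ->; apply: stop => //=.
  by rewrite orbF.
have : step c = let: (q, act) := order_trans (inl b) [ffun i => read (ctapes c i)] in
     @Config order_machine q [ffun i => move_head (act i).2 (write (act i).1 (ctapes c i))].
  by rewrite /step /halted /accepting es.
rewrite /= !ffunE {1 2}/read e0 e1; case: y e1 => [|d y] e1 /= ->; first exact: stop.
rewrite covers_cons; case: ifP => da; last by apply: stop.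
rewrite (IH y (b || (a != d))) //=; last first.
- by rewrite !ffunE /= e1.
- by rewrite !ffunE /= e0.
by rewrite eqseq_cons negb_and orbA.
Qed.

Lemma more_ones_polytime : polytime_relation more_ones.
Proof.
exists order_machine, ('X + 1%:P)%R => x y.
set c := iter _ _ _.
have e : cstate c = inr (more_ones x y).
  rewrite /c hornerD hornerX hornerC.
  by apply: (@order_machine_run x y false); rewrite //= ?ffunE //; lia.
by split; rewrite /halted /accepting e; case: (more_ones x y).
Qed.

Lemma more_ones_OK : OK_order more_ones.
Proof.
split; [exact: more_ones_order|exact: more_ones_polytime|].
exists ('X + 1%:P)%R; split=> [[|x s] //= h|x y h]; rewrite !hornerE /=.
  have [h1 h2] := more_ones_chain h; have := count_size id x; rewrite h2; lia.
by rewrite (more_ones_size h); lia.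
Qed.

Lemma set_nth_more_ones x p : onth x p = Some false -> more_ones (set_nth false x p true) x.
Proof.
elim: x p => [|a x IH] [|p] //= => [[->]|/IH].
  rewrite /more_ones covers_cons eqseq_cons /= andbT.
  by elim: x {IH} => //= b x IH; rewrite covers_cons implybb.
by rewrite /more_ones covers_cons eqseq_cons implybb eqxx.
Qed.

(** * From one-step extensions to self-reducibility *)

Section OneStep.
Variables (tau : signature) (C : class tau) (phi : fo tau) (S : pred tau).

Hypothesis one_step : forall n (I : forall R : tau, (ar R).-tuple 'I_n.+1 -> Prop),
  C (structure_on I) <->
  @sat tau (structure_on I) (fun=> ord0) phi \/
  exists R (t : (ar R).-tuple 'I_n.+1), [/\ S R, ~ I R t & C (structure_on (add_tuple I t))].

Lemma language_encode n (I : forall R : tau, (ar R).-tuple 'I_n.+1 -> Prop) :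
  language_of C (encode I) <-> C (structure_on I).
Proof.
split=> [[n' [I' [h e]]]|h]; last by exists n, I.
have en : n' = n by have := leading_encode I; rewrite e leading_encode => -[].
by case: _ / en I e => I e; rewrite (encode_inj e).
Qed.

Lemma language_valid x : language_of C x ->
  headed x /\ size x = code_size tau (leading x).-1.
Proof. by case=> n [I [_ ->]]; rewrite headed_encode leading_encode size_encode. Qed.

(** If [phi] fails, then [C] holds for the input if and only if the oracle
    accepts one of the queries, by [one_step] and [language_encode]; the answers
    are only needed as a disjunction. *)
Theorem one_step_self_reducible : class_disjunctive_self_reducible C.
Proof.
exists more_ones; split; first exact: more_ones_OK.
(* There must be a register for each nested quantifier, besides register 0, and
   for each entry of a tuple. *)
pose D := (depth phi).+1 + \max_(R : tau) ar R.
have ar_le (R : tau) : ar R <= D by rewrite (leq_trans (@leq_bigmax _ (fun R : tau => ar R) R)) ?leq_addl.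
have depth_lt : depth phi < D by rewrite /D addSn ltnS leq_addr.
have [pt HM] := oracle_machineP (ans D) (proper_self_reduction ar_le S depth_lt).
set M := machine_of _ _ in pt HM.
exists M; split=> // x; have [hacc hq] := HM (language_of C) x.
case hx : (headed x) hacc hq => hacc hq; last first.
  split; last by left; apply/seteqP; split=> // q /hq[].
  by rewrite hacc; split=> [[]|/language_valid[]] //; rewrite hx.
have [sz|nsz] := eqVneq (size x) (code_size tau (leading x).-1); last first.
  have [e1 e2] := run_invalid ar_le phi S (language_of C) hx nsz.
  split; last by left; apply/seteqP; split=> // q /hq[_]; rewrite e2.
  by rewrite hacc e1; split=> [[]|/language_valid[_ /eqP]] //; rewrite (negPf nsz).
have [lt0 _] := andP hx.
have [n [I ex]] : exists n (I : forall R : tau, (ar R).-tuple 'I_n.+1 -> Prop), encode I = x.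
  by exists (leading x).-1; apply: encode_onto => //; rewrite prednK.
rewrite -{x hx sz lt0}ex in hacc hq *.
have := run_encode ar_le S depth_lt (language_of C) I.
rewrite language_encode one_step; case: asboolP => hphi [e1 e2].
  split; last by left; apply/seteqP; split=> // q /hq[_]; rewrite e2.
  by rewrite hacc; split=> // _; left.
have hL : (exists R (t : (ar R).-tuple 'I_n.+1), [/\ S R, ~ I R t & C (structure_on (add_tuple I t))]) <->
    exists q, q \in slog (run_of (ans D) (language_of C) (self_reduction D phi S) (encode I)) /\
              language_of C q.
  split=> [[R [t [h1 h2 h3]]]|[q [/e2[R [t [h1 h2 ->]]] /language_encode h3]]].
    by exists (encode (add_tuple I t)); split; [apply/e2; exists R, t|apply/language_encode].
  by exists R, t.
split.
  rewrite hacc e1; split=> [[_ /hasP[q h1 /asboolP h2]]|[//|/hL[q [h1 h2]]]].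
    by right; apply/hL; exists q.
  by split=> //; apply/hasP; exists q => //; apply/asboolP.
right; split=> [q /hq[_ /e2[R [t [_ nI ->]]]]|].
  rewrite /= encode_add_tuple; apply: set_nth_more_ones.
  by rewrite onth_encode; congr Some; apply/asboolPn.
split=> [[//|/hL[q [h1 h2]]]|[q [/hq[_ h1] h2]]].
  by exists q; split=> //; apply/hq.
by right; apply/hL; exists q.
Qed.

End OneStep.

(** * First-order logic *)

Lemma structure_on_finite (tau : signature) n (I : forall R : tau, (ar R).-tuple 'I_n.+1 -> Prop) :
  finite_structure (structure_on I).
Proof. exact: finite_finset. Qed.

Section Formulas.
Variable sigma : signature.
Implicit Types (A : structure sigma) (p q : fo sigma).

Lemma eq_sat A (e e' : nat -> A) p :
  (forall x, x \in free_vars p -> e x = e' x) -> sat e p <-> sat e' p.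
Proof.
have upd_ext (f f' : nat -> A) x a q :
    (forall y, y \in [seq y <- free_vars q | y != x] -> f y = f' y) ->
    forall y, y \in free_vars q -> update f x a y = update f' x a y.
  move=> h y hy; rewrite /update; case: eqVneq => // nyx.
  by apply: h; rewrite mem_filter nyx.
elim: p e e' => [|x y|R v|p IH|p IHp q IHq|p IHp q IHq|p IHp q IHq|x p IH|x p IH] e e' h //=.
- by rewrite !h ?inE ?eqxx ?orbT.
- suff -> : map_tuple e v = map_tuple e' v by [].
  by apply/val_inj/eq_in_map => x xv; apply: h.
- by rewrite (IH _ _ h).
- by rewrite (IHp e e') ?(IHq e e') // => x hx; apply: h; rewrite /= mem_cat hx ?orbT.
- by rewrite (IHp e e') ?(IHq e e') // => x hx; apply: h; rewrite /= mem_cat hx ?orbT.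
- by rewrite (IHp e e') ?(IHq e e') // => x hx; apply: h; rewrite /= mem_cat hx ?orbT.
- by split=> H a; apply/(IH _ _ (upd_ext _ _ _ a _ h)).
- by split=> -[a H]; exists a; apply/(IH _ _ (upd_ext _ _ _ a _ h)).
Qed.

Lemma sat_foldr_all A p (xs : seq nat) :
  (forall e : nat -> A, sat e (foldr (@FAll sigma) p xs)) <-> forall e : nat -> A, sat e p.
Proof.
elim: xs => //= x xs <-; split=> H e; last by move=> a; apply: H.
have -> : e = update e x (e x) by apply/funext => y; rewrite /update; case: eqP => [->|].
exact: H.
Qed.

Lemma occurrences_foldr (P : sigma) p (xs : seq nat) :
  occurrences P (foldr (@FAll sigma) p xs) = occurrences P p.
Proof. by elim: xs. Qed.

End Formulas.

Section Transfer.
Variables (sigma : signature) (T : Type) (inh : inhabited T) (P : sigma).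
Variables (X Y : forall R : sigma, (ar R).-tuple T -> Prop).
Hypothesis agree : forall R, R != P -> @X R = @Y R.

Local Notation SX := (@Structure sigma T inh X).
Local Notation SY := (@Structure sigma T inh Y).

Lemma sat_transfer (p : fo sigma) (e : nat -> T) : occurrences P p = 0 ->
  @sat sigma SX e p <-> @sat sigma SY e p.
Proof.
elim: p e => [|x y|R v|p IH|p IHp q IHq|p IHp q IHq|p IHp q IHq|x p IH|x p IH] e //=.
- by case: eqP => // /eqP nRP _; rewrite agree.
- by move=> /IH ->.
- by move/eqP; rewrite addn_eq0 => /andP[/eqP/IHp -> /eqP/IHq ->].
- by move/eqP; rewrite addn_eq0 => /andP[/eqP/IHp -> /eqP/IHq ->].
- by move/eqP; rewrite addn_eq0 => /andP[/eqP/IHp -> /eqP/IHq ->].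
- by move=> /IH h; split=> H a; apply/h.
- by move=> /IH h; split=> -[a H]; exists a; apply/h.
Qed.

Lemma conjunct_occurrences (psi p : fo sigma) :
  conjunct psi p -> occurrences P psi <= occurrences P p.
Proof.
elim: p => [|x y|R v|p IH|p IHp q IHq|p IHp q IHq|p IHp q IHq|x p IH|x p IH] [->|] //.
by move=> /= [/IHp|/IHq] h; apply: leq_trans h _; [exact: leq_addr|exact: leq_addl].
Qed.

(** The only occurrence of [P] lies in [psi], so the other conjuncts do not
    notice a change of [P]. *)
Lemma sat_transfer_conjunct (psi p : fo sigma) (e : nat -> T) :
  conjunct psi p -> 0 < occurrences P psi -> occurrences P p = 1 ->
  @sat sigma SY e psi -> @sat sigma SX e p -> @sat sigma SY e p.
Proof.
elim: p => [|x y|R v|p IH|p IHp q IHq|p IHp q IHq|p IHp q IHq|x p IH|x p IH] [<-|] //=.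
move=> [hc|hc] o1 o2 hY [hp hq]; have := conjunct_occurrences hc => le.
- have oq : occurrences P q = 0 by lia.
  split; last exact/(sat_transfer _ oq).
  by apply: IHp => //; lia.
- have op : occurrences P p = 0 by lia.
  split; first exact/(sat_transfer _ op).
  by apply: IHq => //; lia.
Qed.

End Transfer.

Lemma conjunct_sat (sigma : signature) (A : structure sigma) (psi p : fo sigma) (e : nat -> A) :
  conjunct psi p -> sat e p -> sat e psi.
Proof.
elim: p => [|x y|R v|p IH|p IHp q IHq|p IHp q IHq|p IHp q IHq|x p IH|x p IH] [<-|] //=.
by move=> [/IHp|/IHq] h [hp hq]; apply: h.
Qed.

(** * Extensional sentences *)

Section Extensional.
Variables (tau : signature) (Phi : eso tau) (input : quantified Phi -> tau).
Local Notation sigma := (quantified Phi).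
Hypothesis arE : forall R : sigma, ar R = ar (input R).

(** The body with the input relations in place of the quantified ones. It holds
    if and only if the smallest candidate for a witness is a witness. *)
Fixpoint input_formula (p : fo (sum_sig tau sigma)) : fo tau :=
  match p with
  | FFalse => FFalse
  | FEq x y => FEq x y
  | FRel R v =>
      match R as Q return (@ar (sum_sig tau sigma) Q).-tuple nat -> fo tau with
      | inl P => fun v => @FRel tau P v
      | inr P => fun v => @FRel tau (input P) (tcast (arE P) v)
      end v
  | FNot p => FNot (input_formula p)
  | FAnd p q => FAnd (input_formula p) (input_formula q)
  | FOr p q => FOr (input_formula p) (input_formula q)
  | FImp p q => FImp (input_formula p) (input_formula q)
  | FAll x p => FAll x (input_formula p)
  | FEx x p => FEx x (input_formula p)
  end.

Definition inputs (A : structure tau) : forall R : sigma, (ar R).-tuple A -> Prop :=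
  fun R t => @interp tau A (input R) (tcast (arE R) t).

Lemma map_tcast (S T : Type) k l (E : k = l) (f : S -> T) (t : k.-tuple S) :
  map_tuple f (tcast E t) = tcast E (map_tuple f t).
Proof. by case: _ / E. Qed.

Lemma tcast_eq (T : Type) k l (E : k = l) (t : k.-tuple T) (u : l.-tuple T) :
  tval t = tval u -> tcast E t = u.
Proof. by case: _ / E u => u /val_inj. Qed.

Lemma sat_input_formula (A : structure tau) (e : nat -> A) p :
  sat e (input_formula p) <-> @sat _ (expansion (@inputs A)) e p.
Proof.
elim: p e => [|x y|[P|P] v|p IH|p IHp q IHq|p IHp q IHq|p IHp q IHq|x p IH|x p IH] e //=.
- by rewrite map_tcast.
- by rewrite IH.
- by rewrite IHp IHq.
- by rewrite IHp IHq.
- by rewrite IHp IHq.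
- by split=> H a; apply/IH.
- by split=> -[a H]; exists a; apply/IH.
Qed.

(** The variables of the axiom are distinct, so every tuple is the value of
    [xs] under some assignment. *)
Lemma sat_extension_axiom (A : structure tau) (J : forall R : sigma, (ar R).-tuple A -> Prop) R psi :
  extension_axiom (given _ (input R)) (added tau R) psi ->
  (forall e : nat -> A, @sat _ (expansion J) e psi) <->
  (forall t, inputs t -> J R t).
Proof.
move=> [xs [ys [ux exy ->]]]; have [a0] := dom_nonempty A.
rewrite (sat_foldr_all (expansion J)).
have eys (e : nat -> A) : tcast (arE R) (map_tuple e ys) = map_tuple e xs.
  by apply: tcast_eq; rewrite /= -exy.
split=> [H t ht|H e /= h]; last by apply: H; rewrite /inputs eys.
pose e x := nth a0 t (index x xs).
have et : map_tuple e ys = t.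
  apply/val_inj; apply: (@eq_from_nth _ a0); rewrite /= size_map size_tuple ?size_tuple // => i lt.
  have lx : i < size xs by rewrite exy size_tuple.
  by rewrite -exy (nth_map 0) // /e index_uniq.
have := H e; rewrite /= et -eys et; exact.
Qed.

End Extensional.

Lemma extension_axiom_occurrences (tau sigma : signature) (P : tau) (R : sigma) psi :
  extension_axiom (given _ P) (added tau R) psi -> occurrences (given sigma P) psi = 1.
Proof. by move=> [xs [ys [_ _ ->]]]; rewrite occurrences_foldr /= eqxx. Qed.

Lemma add_tuple_neq (tau : signature) n (I : forall R : tau, (ar R).-tuple 'I_n.+1 -> Prop)
    (P : tau) (t : (ar P).-tuple 'I_n.+1) (Q : tau) :
  Q != P -> @add_tuple tau n I P t Q = @I Q.
Proof.
move=> nQ; apply/funext => u; apply/propext; split=> [[//|e]|]; last by left.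
by case/eqP: nQ; exact: (congr1 (@projT1 _ _) e).
Qed.

(** A witness that differs from the input relations allows to add a tuple to one
    of them; conversely, a witness for the enlarged input is one for the smaller
    input, whose extension axioms are weaker. *)
Theorem extensional_self_reducible (tau : signature) (C : class tau) :
  extensional_eso_expressible C -> class_disjunctive_self_reducible C.
Proof.
move=> [Phi [[input [_ hin]] hC]].
have arE (R : quantified Phi) : ar R = ar (input R).
  have [[psi [[xs [ys [_ exy _]]] _]] _] := hin R.
  by rewrite -[LHS](size_tuple ys) -exy size_tuple.
apply: (@one_step_self_reducible tau C (input_formula arE (body Phi)) (fun P => P \in codom input)).
move=> n I; rewrite hC.
pose AI := structure_on I.
(* Replacing [I1] by [I2] at one input symbol keeps a witness as long as its
   extension axiom remains true. *)
have transfer R (J : forall R : quantified Phi, (ar R).-tuple 'I_n.+1 -> Prop)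
    (I1 I2 : forall P : tau, (ar P).-tuple 'I_n.+1 -> Prop) :
    (forall P, P != input R -> I1 P = I2 P) ->
    (forall u, @inputs tau Phi input arE (structure_on I2) R u -> J R u) ->
    (forall e, @sat _ (@expansion tau _ (structure_on I1) J) e (body Phi)) ->
    forall e, @sat _ (@expansion tau _ (structure_on I2) J) e (body Phi).
  move=> agree h2 h1 e; have [[psi [ax cj]] occ] := hin R.
  have h2' := (@sat_extension_axiom tau Phi input arE (structure_on I2) J R psi ax).2 h2.
  apply: (sat_transfer_conjunct (P := given _ (input R)) _ cj _ occ (h2' e) (h1 e)).
    by case=> [P|P] nP //=; rewrite agree.
  by rewrite (extension_axiom_occurrences ax).
split=> [[_ [J hJ]]|].
  case: (pselect (forall R t, J R t -> @inputs tau Phi input arE AI R t)) => [all_in|].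
    left; apply/sat_input_formula.
    suff -> : @inputs tau Phi input arE AI = J by exact: hJ.
    apply: functional_extensionality_dep => R; apply/funext => t; apply/propext; split; last exact: all_in.
    have [[psi [ax cj]] _] := hin R.
    by apply: (@sat_extension_axiom tau Phi input arE AI J R psi ax).1 => e; apply: conjunct_sat cj (hJ e).
  move=> nall; right.
  have [R [t [hJt nt]]] : exists R t, J R t /\ ~ @inputs tau Phi input arE AI R t.
    apply: contrapT => no; apply: nall => R t h; apply: contrapT => nt.
    by apply: no; exists R, t.
  exists (input R), (tcast (arE R) t); split=> //; first exact: codom_f.
  apply/hC; split; first exact: structure_on_finite.
  exists J; apply: (transfer R J I) => //.
  - by move=> P nP; rewrite add_tuple_neq.
  - have [[psi [ax cj]] _] := hin R; move=> u [hu|e].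
      by apply: (@sat_extension_axiom tau Phi input arE AI J R psi ax).1 hu => e; apply: conjunct_sat cj (hJ e).
    have er : tuple_rank (tcast (arE R) u) = tuple_rank (tcast (arE R) t).
      exact: (congr1 (fun w => tuple_rank (projT2 w)) e).
    suff -> : u = t by [].
    apply: (can_inj (tcastK (arE R))).
    by rewrite -(lex_tuple_rank (tcast _ u)) er lex_tuple_rank.
move=> h; split; first exact: structure_on_finite.
case: h => [h|[P [t [/codomP[R eP] nI /hC[_ [J hJ]]]]]].
  exists (@inputs tau Phi input arE AI) => e.
  apply/(@eq_sat _ (expansion (@inputs tau Phi input arE AI)) (fun=> ord0)).
    by rewrite body_sentence.
  exact/sat_input_formula.
subst P; exists J; apply: (transfer R J (add_tuple I t)) => //.
- by move=> P nP; rewrite add_tuple_neq.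
- have [[psi [ax cj]] _] := hin R; move=> u hu.
  apply: (@sat_extension_axiom tau Phi input arE (structure_on (add_tuple I t)) J R psi ax).1 => [e|].
    exact: conjunct_sat cj (hJ e).
  by left.
Qed.

(** * Finitely bounded structures *)

Lemma map_tuple_comp (S T U : Type) k (f : T -> U) (g : S -> T) (t : k.-tuple S) :
  map_tuple f (map_tuple g t) = map_tuple (f \o g) t.
Proof. by apply/val_inj; rewrite /= -map_comp. Qed.

Definition set_entry (D : Type) k (t : k.-tuple D) (i : 'I_k) (a : D) : k.-tuple D :=
  [tuple if j == i then a else tnth t j | j < k].

Lemma map_set_entry (S T : Type) k (f : S -> T) (t : k.-tuple S) i a :
  map_tuple f (set_entry t i a) = set_entry (map_tuple f t) i (f a).
Proof. by apply: eq_from_tnth => j; rewrite !(tnth_map, tnth_mktuple); case: eqP. Qed.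

Section Twins.
Variables (tau : signature) (A : structure tau).

(** Whenever a homomorphism preserves and reflects all relations, elements with
    the same image are twins. *)
Definition twin (a b : A) := forall (R : tau) (t : (ar R).-tuple A) (i : 'I_(ar R)),
  interp (set_entry t i a) <-> interp (set_entry t i b).

Lemma twin_refl a : twin a a. Proof. by []. Qed.

Lemma twin_sym a b : twin a b -> twin b a.
Proof. by move=> h R t i; split=> /h. Qed.

Lemma twin_trans b a c : twin a b -> twin b c -> twin a c.
Proof. by move=> h1 h2 R t i; rewrite (h1 R t i). Qed.

Lemma twin_congr (R : tau) (t u : (ar R).-tuple A) :
  (forall j, twin (tnth t j) (tnth u j)) -> interp t -> interp u.
Proof.
move=> h; pose v m : (ar R).-tuple A := [tuple if j < m then tnth u j else tnth t j | j < ar R].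
(* [v m] agrees with [u] on the first [m] entries and with [t] on the others;
   from [v m] to [v m.+1] a single entry is replaced by a twin. *)
have v0 : v 0 = t by apply: eq_from_tnth => j; rewrite tnth_mktuple.
have vk : v (ar R) = u by apply: eq_from_tnth => j; rewrite tnth_mktuple ltn_ord.
rewrite -{1}v0 -{1}vk => h0.
have : forall m, m <= ar R -> interp (v m); last exact.
elim=> [//|m IH] lt; pose i := Ordinal lt.
have e1 : v m = set_entry (v m) i (tnth t i).
  apply: eq_from_tnth => j; rewrite !tnth_mktuple; case: eqP => [->|//].
  by rewrite /= ltnn.
have -> : v m.+1 = set_entry (v m) i (tnth u i).
  apply: eq_from_tnth => j; rewrite !tnth_mktuple; case: eqP => [->|/eqP].
    by rewrite /= leqnn.
  by rewrite -val_eqE /= ltnS leq_eqVlt => /negPf ->.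
by apply/(h i); rewrite -e1; apply: IH; exact: ltnW.
Qed.

(** Twins satisfy the same predicates [twin a], so it suffices to choose one
    element of each nonempty predicate. *)
Lemma exists_canon : exists canon : A -> A,
  (forall a, twin a (canon a)) /\ (forall a b, twin a b -> canon a = canon b).
Proof.
have [a0] := dom_nonempty A.
have /choice[pick hp] : forall P : A -> Prop, exists a, (exists b, P b) -> P a.
  by move=> P; case: (pselect (exists b, P b)) => [[b Pb]|nP]; [exists b|exists a0].
exists (fun a => pick (twin a)); split=> [a|a b ab].
  by apply: hp; exists a; exact: twin_refl.
congr pick; apply/funext => c; apply/propext; split=> h.
  exact: twin_trans (twin_sym ab) h.
exact: twin_trans ab h.
Qed.

End Twins.

Section Quotient.
Variables (tau : signature) (A : structure tau) (canon : A -> A).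
Hypothesis canon_twin : forall a, twin a (canon a).
Hypothesis canon_eq : forall a b, twin a b -> canon a = canon b.

Lemma canonK a : canon (canon a) = canon a.
Proof. exact/esym/canon_eq/canon_twin. Qed.

Definition rep_type := {a : A | canon a = a}.
Definition rep (a : A) : rep_type := exist _ (canon a) (canonK a).

Lemma rep_type_inhabited : inhabited rep_type.
Proof. by have [a] := dom_nonempty A; split; exact: rep a. Qed.

Definition quotient : structure tau :=
  @Structure tau rep_type rep_type_inhabited (fun R t => interp (map_tuple sval t)).

Lemma rep_sval (r : rep_type) : rep (sval r) = r.
Proof. by case: r => a ha; apply: eq_exist. Qed.

Lemma rep_interp (R : tau) (t : (ar R).-tuple A) :
  @interp tau quotient R (map_tuple rep t) <-> interp t.
Proof.
have -> : @interp tau quotient R (map_tuple rep t) = interp (map_tuple canon t).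
  by rewrite /= map_tuple_comp.
split; apply: twin_congr => j; rewrite !tnth_map /=; last exact: canon_twin.
exact/twin_sym/canon_twin.
Qed.

Lemma rep_inj a b : rep a = rep b -> twin a b.
Proof.
move=> /(congr1 sval) /= e; apply: twin_trans (canon_twin a) _.
by rewrite e; apply/twin_sym/canon_twin.
Qed.

Lemma quotient_finite : finite_structure A -> finite_structure quotient.
Proof.
move=> fA; rewrite /finite_structure (_ : (@classical_sets.setT quotient) = (rep @` classical_sets.setT)%classic).
  exact: finite_image.
by apply/seteqP; split=> // r _; exists (sval r) => //; exact: rep_sval.
Qed.

(** These maps are the embeddings of [F] into the quotient, composed with a
    choice of representatives; they can be described without the quotient. *)
Definition thick (F : structure tau) (g : F -> A) :=
  (forall a b, a <> b -> ~ twin (g a) (g b)) /\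
  (forall (R : tau) (t : (ar R).-tuple F), interp t <-> interp (map_tuple g t)).

Lemma embeds_quotient (F : structure tau) :
  embeds F quotient <-> exists g : F -> A, thick g.
Proof.
split=> [[h [hinj hR]]|[g [gtw gR]]].
  exists (sval \o h); split=> [a b nab tw|R t].
    apply: nab; apply: hinj; rewrite -(rep_sval (h a)) -(rep_sval (h b)).
    by apply: eq_exist; exact: canon_eq tw.
  by rewrite hR /= map_tuple_comp.
exists (rep \o g); split=> [a b /rep_inj tw|R t].
  by apply: contrapT => nab; exact: gtw nab tw.
rewrite gR; have -> : map_tuple (rep \o g) t = map_tuple rep (map_tuple g t) by rewrite map_tuple_comp.
by split=> h; apply/rep_interp.
Qed.

End Quotient.

(** ** A first-order description of the bounds *)

Section Definability.
Variable tau : signature.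
Implicit Types (P Q : forall A : structure tau, (nat -> A) -> Prop).

Definition definable P :=
  exists phi : fo tau, forall (A : structure tau) (e : nat -> A), sat e phi <-> P A e.

Lemma definable_not P : definable P -> definable (fun A e => ~ P A e).
Proof. by move=> [p hp]; exists (FNot p) => A e; rewrite /= hp. Qed.

Lemma definable_and P Q : definable P -> definable Q -> definable (fun A e => P A e /\ Q A e).
Proof. by move=> [p hp] [q hq]; exists (FAnd p q) => A e; rewrite /= hp hq. Qed.

Lemma definable_imp P Q : definable P -> definable Q -> definable (fun A e => P A e -> Q A e).
Proof. by move=> [p hp] [q hq]; exists (FImp p q) => A e; rewrite /= hp hq. Qed.

Lemma definable_iff P Q : definable P -> definable Q -> definable (fun A e => P A e <-> Q A e).
Proof. by move=> hP hQ; apply: definable_and; exact: definable_imp. Qed.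

Lemma definable_const (B : Prop) : definable (fun _ _ => B).
Proof.
case: (pselect B) => hB; first by exists (FNot FFalse) => A e /=; split=> // _ [].
by exists FFalse => A e.
Qed.

Lemma definable_rel (R : tau) (v : (ar R).-tuple nat) :
  definable (fun A e => interp (map_tuple e v)).
Proof. by exists (FRel v). Qed.

Lemma definable_all (T : finType) (P : T -> forall A : structure tau, (nat -> A) -> Prop) :
  (forall i, definable (P i)) -> definable (fun A e => forall i, P i A e).
Proof.
move=> h; suff [p hp] : definable (fun A e => forall i, i \in enum T -> P i A e).
  by exists p => A e; rewrite hp; split=> H i *; apply: H; rewrite ?mem_enum.
elim: (enum T) => [|i s [p hp]]; first by exists (FNot FFalse) => A e /=; split=> // _ [].
have [q hq] := h i; exists (FAnd q p) => A e /=; rewrite hq hp.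
split=> [[h1 h2] j|H]; first by rewrite inE => /orP[/eqP ->|/h2].
by split=> [|j js]; apply: H; rewrite inE ?eqxx ?js ?orbT.
Qed.

(** A block of quantifiers is described by assignments that agree outside of its
    variables, which avoids any bookkeeping of tuples of values. *)
Lemma definable_forall (xs : seq nat) P : definable P ->
  definable (fun A e => forall e', (forall x, x \notin xs -> e' x = e x) -> P A e').
Proof.
elim: xs P => [|x xs IH] P hP.
  have [p hp] := hP; exists p => A e; rewrite hp; split=> [h e' he|]; last exact.
  by have -> : e' = e by apply/funext => x; apply: he.
have [p hp] := IH P hP; exists (FAll x p) => A e /=; split=> [H e' he|H a].
  apply: ((hp A (update e x (e' x))).1 (H (e' x))) => y ny.
  by rewrite /update; case: eqVneq => [->//|nyx]; apply: he; rewrite inE negb_or nyx.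
apply/hp => e' he; apply: H => y; rewrite inE negb_or => /andP[nyx ny].
by rewrite he // /update (negPf nyx).
Qed.

Lemma definable_twin (x y : nat) : definable (fun A e => twin (e x) (e y)).
Proof.
(* Variables from [m] on differ from [x] and [y]. *)
pose m := (maxn x y).+1.
pose vars k : k.-tuple nat := [tuple m + i | i < k].
pose P (R : tau) (i : 'I_(ar R)) (A : structure tau) (e : nat -> A) :=
  forall e', (forall z, z \notin iota m (ar R) -> e' z = e z) ->
    interp (map_tuple e' (set_entry (vars (ar R)) i x)) <->
    interp (map_tuple e' (set_entry (vars (ar R)) i y)).
have [phi hphi] : definable (fun A e => forall (R : tau) (i : 'I_(ar R)), @P R i A e).
  apply: definable_all => R; apply: definable_all => i; apply: definable_forall.
  by apply: definable_iff; exact: definable_rel.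
exists phi => A e; rewrite hphi.
have out k z : z <= maxn x y -> z \notin iota m k by rewrite mem_iota; lia.
split=> [H R t i|H R i e' he]; last first.
  by rewrite !map_set_entry !(he _ (out _ _ _)) ?leq_maxl ?leq_maxr //; exact: H.
pose e' z := if z \in iota m (ar R) then nth (e 0) t (z - m) else e z.
have he z : z \notin iota m (ar R) -> e' z = e z by rewrite /e' => /negPf ->.
have et : map_tuple e' (vars (ar R)) = t.
  apply: eq_from_tnth => j; rewrite tnth_map tnth_mktuple /e' mem_iota leq_addr ltn_add2l ltn_ord /=.
  by rewrite addKn -tnth_nth.
have := H R i e' he; rewrite !map_set_entry et !he ?out ?leq_maxl ?leq_maxr //.
Qed.

Lemma finite_numbering (F : structure tau) : finite_structure F ->
  exists n (f : 'I_n -> F) (g : F -> 'I_n), cancel f g /\ cancel g f.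
Proof.
move=> /finite_setP[n /card_set_bijP[h [hfun hinj hsurj]]].
have hlt a : h a < n by exact: hfun.
have /choice[f hf] : forall i : 'I_n, exists a, h a = i.
  by move=> i; have [a _ e] := hsurj i (ltn_ord i); exists a.
exists n, f, (fun a => Ordinal (hlt a)); split=> [i|a]; first by apply/val_inj; exact: hf.
by apply: hinj; rewrite ?inE // hf.
Qed.

Lemma definable_no_thick (F : structure tau) : finite_structure F ->
  definable (fun A e => ~ exists g : F -> A, thick g).
Proof.
move=> /finite_numbering[n [f [c [fK cK]]]].
pose P (A : structure tau) (e : nat -> A) :=
  (forall a b : 'I_n, a <> b -> ~ twin (e a) (e b)) /\
  (forall (R : tau) (t : (ar R).-tuple 'I_n),
     interp (map_tuple f t) <-> interp (map_tuple e (map_tuple (@nat_of_ord n) t))).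
have hP : definable P.
  apply: definable_and.
    apply: definable_all => a; apply: definable_all => b.
    apply: definable_imp; first exact: definable_const.
    exact/definable_not/definable_twin.
  apply: definable_all => R; apply: definable_all => t.
  by apply: definable_iff; [exact: definable_const|exact: definable_rel].
have [phi hphi] := definable_forall (iota 0 n) (definable_not hP).
exists phi => A e; rewrite hphi; split=> [H [g [gtw gR]]|H e' _ [etw eR]].
  pose e' z := if insub z is Some i then g (f i) else e z.
  have ee (i : 'I_n) : e' i = g (f i) by rewrite /e' valK.
  apply: (H e') => [z|].
    by rewrite mem_iota add0n /= /e' => nz; rewrite insubN.
  split=> [a b nab|R t]; first by rewrite !ee; apply: gtw => /(can_inj fK).
  rewrite gR !map_tuple_comp; suff -> : map_tuple (g \o f) t = map_tuple (e' \o @nat_of_ord n) t by [].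
  by apply: eq_from_tnth => j; rewrite !tnth_map /= ee.
apply: H; exists (fun a => e' (c a)); split=> [a b nab|R t].
  by apply: etw => /(can_inj cK).
have {1}-> : t = map_tuple f (map_tuple c t).
  by apply: eq_from_tnth => j; rewrite !tnth_map cK.
by rewrite eR !map_tuple_comp.
Qed.

End Definability.

(** The formula describes the embeddability of the quotient by twins into [B].
    The quotient maps homomorphically to [B] if it embeds, and a homomorphism
    that reflects all relations embeds it. *)
Theorem csp_self_reducible (tau : signature) (B : structure tau) :
  finitely_bounded B -> class_disjunctive_self_reducible (CSP B).
Proof.
move=> [k [F [fF hF]]].
have [phi hphi] : definable (fun (A : structure tau) e => forall i, ~ exists g : F i -> A, thick g).
  by apply: definable_all => i; exact: definable_no_thick.
apply: (@one_step_self_reducible tau (CSP B) phi predT) => n I.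
pose A := structure_on I; have fA : finite_structure A by exact: structure_on_finite.
have [canon [ctw ceq]] := exists_canon A.
have hQ : embeds (quotient ctw ceq) B <-> @sat tau A (fun=> ord0) phi.
  rewrite (hF _ (quotient_finite ctw ceq fA)) hphi.
  by split=> H i; move: (H i); rewrite embeds_quotient.
split=> [[_ [h hh]]|[/hQ[h [_ hR]]|[R [t [_ _ [_ [h hh]]]]]]].
- case: (pselect (forall R (t : (ar R).-tuple A), interp (map_tuple h t) -> interp t)) => [strong|].
    left; apply/hQ; exists (h \o sval); split=> [a b /= e|R t].
      rewrite -(rep_sval ctw ceq a) -(rep_sval ctw ceq b); apply: eq_exist; apply: (ceq _ _ _) => R t i.
      have eh : map_tuple h (set_entry t i (sval a)) = map_tuple h (set_entry t i (sval b)).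
        by rewrite !map_set_entry e.
      by split=> /hh; [rewrite eh|rewrite -eh]; exact: strong.
    rewrite /= -map_tuple_comp; split; [exact: hh|exact: strong].
  move=> nstrong; right.
  have [R [t [hB nI]]] : exists R (t : (ar R).-tuple A), interp (map_tuple h t) /\ ~ interp t.
    apply: contrapT => no; apply: nstrong => R t hB; apply: contrapT => nI.
    by apply: no; exists R, t.
  exists R, t; split=> //; split; first exact: structure_on_finite.
  exists h => R' t' [/hh //|e].
  have e' := congr1 (fun w : {R & (ar R).-tuple A} => interp (map_tuple h (projT2 w))) e.
  by rewrite /= in e'; rewrite e'.
- split=> //; exists (h \o rep ctw ceq) => R t hI.
  by rewrite -map_tuple_comp -hR; apply/rep_interp.
- split=> //; exists h => R' t' hI; apply: hh; by left.
Qed.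

Theorem lemma7p1 (tau : signature) :
  (forall C : class tau,
     extensional_eso_expressible C -> class_disjunctive_self_reducible C) /\
  (forall B : structure tau,
     finitely_bounded B -> class_disjunctive_self_reducible (CSP B)).
Proof.
by split=> [C|B]; [exact: extensional_self_reducible|exact: csp_self_reducible].
Qed.
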